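(* Let $X$ be an orthosymmetric convex set (in $\mathbb{R}^n$ or in sequence space $\mathbb{R}^{\mathbb{N}}$). Then $$\frac{1}{8\sqrt{\log3}}\,\frac1{\sqrt k}\,\sup_{x\in X}\|x\|_1\ \le\ \mathfrak{M}^{\mathsf S}_k(X,\|\cdot\|_\infty).$$ If additionally $X$ has finite effective dimension $N=\mathrm{effdim}(X)$, then $$\mathfrak{M}^{\mathsf R}_k(X,\|\cdot\|_\infty)\ \le\ O(1)\cdot\sqrt{\log N}\,\frac1{\sqrt k}\,\sup_{x\in X}\|x\|_1,$$ where $O(1)$ is a universal numerical constant. Letting $\beta=\frac1{\log N}$ and defining the operator $A$ by $Ax=(j^\beta x_j)_{j\ge1}$, the mirror descent method with distance generating function $h(x)=\frac1{2(p-1)}\|Ax\|_p^2$ for $p=\frac2{2-\beta}$ achieves this regret.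
   Context: $X$ is orthosymmetric if $x\in X$ and $\sigma_j\in\{\pm1\}$ for all $j$ imply $(\sigma_jx_j)_{j\ge1}\in X$. The effective dimension of $X$ is $$\mathrm{effdim}(X)=\inf_{\beta\ge0}\Big\{e^{1/\beta}\ :\ \sup_{x\in X}\sum_{j\ge1}j^\beta|x_j|\le e\sup_{x\in X}\|x\|_1\Big\},$$ with $\mathrm{effdim}(X)=+\infty$ if only $\beta=0$ satisfies the inequality. Let $E$ be the ambient space of $X$ ($\mathbb{R}^n$ or $\mathbb{R}^{\mathbb{N}}$). For a sample space $\mathcal{S}$, let $\mathcal{F}$ be the collection of functions $F:E\times\mathcal{S}\to\mathbb{R}$, convex in the first argument, such that $\|g\|_\infty\le1$ for all $x\in E$, $s\in\mathcal{S}$ and all subgradients $g\in\partial_xF(x,s)$. For a distribution $P$ on $\mathcal{S}$ let $f_P(x)=\int F(x,s)\,dP(s)$. The minimax stochastic risk is $$\mathfrak{M}^{\mathsf S}_k(X,\|\cdot\|_\infty)=\sup_{\mathcal{S}}\ \sup_{\mathcal{P}}\ \inf_{\hat x_k}\ \sup_{F\in\mathcal{F}}\ \sup_{P\in\mathcal{P}}\ \mathbb{E}\Big[f_P(\hat x_k(S_1^k))-\inf_{x\in X}f_P(x)\Big],$$ where $\mathcal{P}$ ranges over collections of distributions on $\mathcal{S}$, the expectation is over $S_1,\dots,S_k$ i.i.d. from $P$, and $\hat x_k$ ranges over measurable functions of $\mathcal{S}^k$. The average minimax regret is $$\mathfrak{M}^{\mathsf R}_k(X,\|\cdot\|_\infty)=\sup_{\mathcal{S}}\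 \inf_{\hat x_{1:k}}\ \sup_{F\in\mathcal{F},\,s_1^k\in\mathcal{S}^k}\ \sup_{x\in X}\ \frac1k\sum_{i=1}^k\big[F(\hat x_i(s_1^{i-1}),s_i)-F(x,s_i)\big],$$ where $\hat x_i$ is chosen conditional on the samples $s_1^{i-1}$. In both cases the points $\hat x$ may lie outside $X$. Mirror descent with distance generating function $h$ and stepsize $\alpha>0$ (chosen appropriately), started at $0$, iterates: $g_i\in\partial_xF(x_i,s_i)$ and $x_{i+1}=\arg\min_x\{\langle g_i,x\rangle+\frac1\alpha D_h(x,x_i)\}$, where $D_h(x,y)=h(x)-h(y)-\langle\nabla h(y),x-y\rangle$.
   Formalization: log N is replaced by max(1, log N), also in β and p; in the regret the learner also sees the past losses F(·,s_j); losses must have a subgradient at every point; k ≥ 1, and sup‖x‖₁ > 0 for mirror descent; the claim fails or is undefined otherwise. *)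

(* Defs.v *)
From HB Require Import structures.
From mathcomp Require Import all_boot all_order all_algebra.
From mathcomp Require Import all_classical all_reals all_analysis.

Set Implicit Arguments.
Unset Strict Implicit.
Unset Printing Implicit Defensive.

Import Order.TTheory GRing.Theory Num.Theory.
Import numFieldNormedType.Exports.

Local Open Scope classical_set_scope.
Local Open Scope ring_scope.

(* [axis (Some m) -> R] is R^m and [axis None -> R] is the space of all real
   sequences. Coordinates are numbered from 1 by [pos]. *)
Definition axis (n : option nat) : choiceType :=
  if n is Some m then 'I_m else nat.

Definition pos (n : option nat) : axis n -> nat :=
  match n with
  | Some m => fun i : 'I_m => i.+1
  | None => fun i : nat => i.+1
  end.

(* This is ln N as soon as e <= N. For N < e the value ln N is too small for the
   regret bound to hold (N = 1 on the real line), and the exponent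
   2 / (2 - 1 / ln N) of the mirror map leaves the interval ]1, 2]. *)
Definition log_dim (R : realType) (N : R) : R := Num.max 1 (ln N).

Section geometry.
Context {R : realType} {n : option nat}.
Local Notation E := (axis n -> R).
Implicit Types (x y g : E) (X : set E) (beta p : R).

Definition orthosymmetric X := forall x (sigma : E), X x ->
  (forall j, sigma j = 1 \/ sigma j = -1) -> X (fun j => sigma j * x j).

Definition norm1 x : \bar R := \esum_(j in [set: axis n]) `|x j|%:E.

Definition sup_norm1 X : \bar R := ereal_sup [set norm1 x | x in X].

Definition weight beta x : E := fun j => (pos j)%:R `^ beta * x j.

(* The convention e^(1/0) = +oo is made explicit, as 0^-1 = 0 here. *)
Definition effdim X : \bar R :=
  ereal_inf [set (if beta == 0%R then +oo else (expR beta^-1)%:E)%E | beta in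
    [set beta | 0 <= beta /\
      (ereal_sup [set norm1 (weight beta x) | x in X]
         <= (expR 1)%:E * sup_norm1 X)%E]].

Definition normp p x : \bar R :=
  ((\esum_(j in [set: axis n]) (`|x j| `^ p)%:E) `^ p^-1)%E.

Definition dist_gen beta p x : \bar R :=
  (((2 * (p - 1))^-1)%:E * normp p (weight beta x) ^+ 2)%E.

(* Finite sum over the support of [g * x]. *)
Definition pairing g x : R := \sum_(j \in [set: axis n]) g j * x j.

(* The dual of R^N is the space of finitely supported sequences; on R^m the
   support condition is void. *)
Definition subdiff (f : E -> R) x : set E := [set g |
  finite_set [set j | g j != 0] /\
  forall y, f x + pairing g (y - x) <= f y].

(* On R^m, [subdiff _ x !=set0] follows from convexity. On R^N it excludes the
   discontinuous convex functions, for which a bound on the subgradients would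
   be vacuous. *)
Definition loss_class (S : Type) : set (E -> S -> R) := [set F |
  forall s, convex_function [set: E] (F^~ s) /\
    forall x, subdiff (F^~ s) x !=set0 /\
      forall g, subdiff (F^~ s) x g -> forall j, `|g j| <= 1].

(* [h] may take the value +oo. The term <grad h(y), x - y> is the directional
   derivative of [h] at [y]. *)
Definition bregman (h : E -> \bar R) x y : \bar R :=
  (h x - h y - (derive1 (fun t : R => fine (h (y + t *: (x - y))%R)) 0%R)%:E)%E.

Definition mirror_obj (h : E -> \bar R) (alpha : R) g y x : \bar R :=
  ((pairing g x)%:E + (alpha^-1)%:E * bregman h x y)%E.

(* [xs i] and [gs i] are the iterate and the subgradient of round [i.+1]. *)
Definition mirror_descent (h : E -> \bar R) (alpha : R) (S : Type) (k : nat)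
    (F : E -> S -> R) (s : k.-tuple S) (xs gs : nat -> E) :=
  xs 0%N = 0 /\
  forall i : 'I_k, subdiff (F^~ (tnth s i)) (xs i) (gs i) /\
    forall x, (mirror_obj h alpha (gs i) (xs i) (xs i.+1)
                 <= mirror_obj h alpha (gs i) (xs i) x)%E.

(* A sample [s] comes with the loss function [F(., s)] it reveals. *)
Definition observe (S : Type) (k : nat) (F : E -> S -> R) (s : k.-tuple S) :
    k.-tuple (S * (E -> R)) := map_tuple (fun z => (z, F^~ z)) s.

Definition avg_regret (S : Type) (k : nat) (F : E -> S -> R) (s : k.-tuple S)
    (xs : nat -> E) x : R :=
  k%:R^-1 * \sum_(i < k) (F (xs i) (tnth s i) - F x (tnth s i)).

(* The point of round [i.+1] is computed from the first [i] observations. *)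
Definition minimax_regret X (k : nat) : \bar R :=
  ereal_sup [set r | exists S : Type, r =
    ereal_inf [set ereal_sup [set r' |
        exists (F : E -> S -> R) (s : k.-tuple S) (x : E),
          [/\ loss_class F, X x & r' =
            (avg_regret F s (fun i => xhat (take i (observe F s))) x)%:E]]
      | xhat in [set: seq (S * (E -> R)) -> E]]].

End geometry.

Section iid.
Context d (S : measurableType d) (R : realType) (P : probability S R).

Definition cons_tuple_pair (k : nat) (z : S * k.-tuple S) : k.+1.-tuple S :=
  [tuple of z.1 :: z.2].

Lemma measurable_cons_tuple_pair (k : nat) :
  measurable_fun [set: S * k.-tuple S] (@cons_tuple_pair k).
Proof. exact: measurable_cons. Qed.

HB.instance Definition _ (k : nat) := isMeasurableFun.Build _ _ _ _
  (@cons_tuple_pair k) (@measurable_cons_tuple_pair k).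

(* Joint law of k independent samples from P. *)
Fixpoint iid (k : nat) : probability (k.-tuple S) R :=
  if k is k'.+1 then distribution (P \x iid k')%E (@cons_tuple_pair k')
  else \d_[tuple].

End iid.

Section stochastic.
Context {R : realType} {n : option nat}.
Local Notation E := (axis n -> R).

Definition coord_measurable d (T : measurableType d) (f : T -> E) :=
  forall j, measurable_fun [set: T] (f^~ j).

Definition risk d (S : measurableType d) (F : E -> S -> R)
    (P : probability S R) (x : E) : \bar R := (\int[P]_s (F x s)%:E)%E.

Definition risk_defined d (S : measurableType d) (F : E -> S -> R)
    (P : probability S R) :=
  forall x, P.-integrable [set: S] (fun s => (F x s)%:E).

Definition expected_excess (X : set E) d (S : measurableType d) (k : nat)
    (F : E -> S -> R) (P : probability S R) (xhat : k.-tuple S -> E) : \bar R :=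
  (\int[iid P k]_s
     (risk F P (xhat s) - ereal_inf [set risk F P x | x in X]))%E.

(* A procedure maps the loss [F] to an estimator. *)
Definition procedures := forall (k : nat) d (S : measurableType d),
  set ((E -> S -> R) -> k.-tuple S -> E).

Definition sample_procedures : procedures := fun k d S =>
  [set fun=> xhat | xhat in [set xhat | coord_measurable xhat]].

(* Estimators that also use the losses [F(., S_i)]. They include the ones
   above, so that a lower bound on their risk is stronger. *)
Definition oracle_procedures : procedures := fun k d S =>
  [set (fun F s => xhat (observe F s)) | xhat in
    [set xhat : k.-tuple (S * (E -> R)) -> E | forall F, loss_class F ->
      coord_measurable (fun s : k.-tuple S => xhat (observe F s))]].

Definition minimax_risk (A : procedures) (X : set E) (k : nat) : \bar R :=
  ereal_sup [set r | exists (d : measure_display) (S : measurableType d)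
      (PP : set (probability S R)), r =
    ereal_inf [set ereal_sup [set r' |
        exists (F : E -> S -> R) (P : probability S R),
          [/\ loss_class F, PP P, risk_defined F P &
              r' = expected_excess X F P (xhat F)]]
      | xhat in A k d S]].

End stochastic.

(* Main.v *)
Require Import Defs.
From HB Require Import structures.
From mathcomp Require Import all_boot all_order all_algebra.
From mathcomp Require Import all_classical all_reals all_analysis.
From mathcomp Require Import measurable_realfun ring lra.

(** Lower bound. Let [x] be in [X] and let [r] be a finite list of coordinates.
    The loss [\sum_(j <- r) `|y j - s j * `|x j| |], where [s] is a vector of
    random signs, has subgradients with entries in [[-1, 1]]. If the signs are
    independent with means [delta * v j], where [v j = 1] or [v j = -1], the risk
    is a sum of one-dimensional tilted absolute values. It is minimal at the point
    [v j * `|x j|], which belongs to [X] by orthosymmetry, and any point whose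
    coordinate [j] has the wrong sign pays [delta * `|x j|] for it
    ([tilted_ge]). So an estimator has to guess the signs [v] from [k] samples.
    When [delta = 1 / (2 * sqrt k)], it misses each sign with probability at least
    one quarter on average over [v] ([two_point_error], [average_error]); the
    expected excess is at least [1 / (8 * sqrt k)] times the sum of [`|x j|]
    ([oracle_minimax_risk_ge]). The factor [sqrt (ln 3) >= 1] is then harmless. The
    estimator may use the losses themselves, hence the bound also covers those that
    only see the samples.

    Upper bound. Mirror descent is followed in the dual. Let [q = 2 / beta] be the
    exponent conjugate to [p]. The conjugate of the distance generating function is
    the potential [dual_gen theta = (p - 1) / 2 * N ^ 2], where [N] is the [q]-norm
    of [j ^ (- beta) * theta j], and its gradient is [mirror_map]. Starting from
    zero, the dual points are minus [alpha] times the sums of past subgradients.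
    They have finite support, which reduces sequences to finite sums.

    - By the Fenchel-Young inequality the image of the next dual point minimizes the
      objective of a step ([mirror_map_argmin]), and smoothness of the potential
      shows that it is the only minimizer ([mirror_map_unique]). This gives the
      existence of mirror descent and describes all its runs.
    - The squared [q]-norm is smooth with a constant of order [q - 1]
      ([sum_powR_smooth]), so the potential has a constant of order one. A step
      increases it by its linear part plus [O(alpha ^ 2)], because a subgradient
      with entries in [[-1, 1]] has a [q]-norm, after weighting, of at most
      [(\sum_j j ^ (-2)) ^ (1 / q)] ([dual_sum_step]).
    - Comparing the last potential with a point [x] of [X] through the Fenchel-Young
      inequality bounds the regret by the generating function at [x], divided by
      [alpha], plus [O(k * alpha)] ([regret_dual_path]). By the definition of the
      effective dimension the weighted [1]-norm of [x], hence its [p]-norm, is at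
      most [e] times the radius of [X] ([effdim_log_dim_weight]), and [1 / (p - 1)]
      is at most [2 / beta = 2 * log_dim N]. The best [alpha] yields the bound with
      the constant [10 * e]. *)

Set Implicit Arguments.
Unset Strict Implicit.
Unset Printing Implicit Defensive.

Import Order.TTheory GRing.Theory Num.Theory.
Import numFieldNormedType.Exports.

Local Open Scope classical_set_scope.
Local Open Scope ring_scope.

(** * Powers of absolute values *)

Section powers.
Context {R : realType}.
Implicit Types (a b l m q r s u v x y : R).

(** Young's inequality, Hölder's inequality and the concavity bound on powers are
    all instances of this one, for suitable [x], [y] and [l]. *)
Lemma weighted_amgm l x y : 0 <= l <= 1 -> 0 <= x -> 0 <= y ->
  x `^ l * y `^ (1 - l) <= l * x + (1 - l) * y.
Proof.
move=> /andP[l0 l1] x0 y0.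
have [->|ln0] := eqVneq l 0; first by rewrite powRr0 subr0 powRr1 // mul0r add0r.
have [->|ln1] := eqVneq l 1.
  by rewrite subrr powRr0 powRr1 // mul0r addr0 mulr1 mul1r.
have lp : 0 < l by rewrite lt0r ln0.
have lq : 0 < 1 - l by rewrite subr_gt0 lt_neqAle ln1.
have := @conjugate_powR R (x `^ l) (y `^ (1 - l)) l^-1 (1 - l)^-1.
rewrite !invr_gt0 !invrK -!powRrM !divff ?gt_eqF // !powRr1 //.
rewrite (mulrC l) (mulrC (1 - l)); apply; rewrite ?powR_ge0 //.
by rewrite addrC subrK.
Qed.

Lemma powR_le_tangent1 l s : 0 <= l <= 1 -> 0 <= s -> s `^ l <= 1 + l * (s - 1).
Proof.
move=> l01 s0; have := weighted_amgm l01 s0 ler01.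
by rewrite powR1 mulr1 => /le_trans; apply; lra.
Qed.

Lemma powR_homo r x y : 0 <= r -> 0 <= x -> x <= y -> x `^ r <= y `^ r.
Proof. by move=> r0 x0 xy; apply: ge0_ler_powR; rewrite ?nnegrE // (le_trans x0). Qed.

Lemma powR_invr x r : 0 <= x -> x^-1 `^ r = (x `^ r)^-1.
Proof. by move=> x0; rewrite -powR_inv1 // -powRrM mulN1r powRN. Qed.

(** An odd power. Since [r + 1] times [spow r] is the derivative of
    [`|u| `^ (r + 1)], it plays the role of a gradient. *)
Definition spow r u : R := Num.sg u * `|u| `^ r.

Lemma spow_opp r u : spow r (- u) = - spow r u.
Proof. by rewrite /spow sgrN normrN mulNr. Qed.

Lemma spow_ge0 r u : 0 <= u -> spow r u = if u == 0 then 0 else u `^ r.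
Proof.
rewrite /spow => u0; case: eqVneq => [->|un0]; first by rewrite sgr0 mul0r.
by rewrite gtr0_sg ?lt0r ?un0 // mul1r gtr0_norm // lt0r un0.
Qed.

Lemma spow_mul q u : 0 < q -> spow (q - 1) u * u = `|u| `^ q.
Proof.
move=> q0; rewrite /spow mulrAC -normrEsg.
by rewrite mulr_powRB1.
Qed.

Lemma normr_spow r u : r != 0 -> `|spow r u| = `|u| `^ r.
Proof.
move=> r0; rewrite /spow normrM normr_sg.
case: eqVneq => [->|_]; first by rewrite mul0r normr0 powR0.
by rewrite mul1r ger0_norm // powR_ge0.
Qed.

Lemma young q x y : 1 < q -> 0 <= x -> 0 <= y ->
  x `^ (q - 1) * y <= (1 - q^-1) * x `^ q + q^-1 * y `^ q.
Proof.
move=> q1 x0 y0; have q0 : 0 < q by lra.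
have l01 : 0 <= 1 - q^-1 <= 1.
  by rewrite subr_ge0 invf_le1 // (ltW q1) /= lerBlDr lerDl invr_ge0 ltW.
have := weighted_amgm l01 (powR_ge0 x q) (powR_ge0 y q).
rewrite subKr -!powRrM divff ?gt_eqF // powRr1 //.
by rewrite mulrBr mulr1 divff ?gt_eqF.
Qed.

(** Young's inequality is exactly the supporting line of the convex function
    [`|u| `^ q]. *)
Lemma powR_norm_tangent q u v : 1 < q ->
  `|v| `^ q + q * spow (q - 1) v * (u - v) <= `|u| `^ q.
Proof.
move=> q1; have q0 : 0 < q by lra.
rewrite mulrBr -[X in _ - X]mulrA spow_mul //.
have : spow (q - 1) v * u <= (1 - q^-1) * `|v| `^ q + q^-1 * `|u| `^ q.
  apply: le_trans (young q1 (normr_ge0 v) (normr_ge0 u)).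
  rewrite (le_trans (ler_norm _)) // normrM normr_spow //; lra.
rewrite -(ler_pM2l q0) mulrDr !mulrA mulrBr divff ?gt_eqF // mul1r mulr1; lra.
Qed.

(** Between points of the same sign this is the tangent inequality at the larger
    one; across zero, both values are bounded by their chords to zero. *)
Lemma spow_lipschitz r m u v : 1 <= r -> `|u| <= m -> `|v| <= m ->
  (spow r u - spow r v) * (u - v) <= r * m `^ (r - 1) * (u - v) ^+ 2.
Proof.
move=> r1.
have pos x y : 0 <= y -> y <= x -> x <= m ->
    spow r x - spow r y <= r * m `^ (r - 1) * (x - y).
  move=> y0 yx xm; have x0 : 0 <= x by exact: le_trans yx.
  have rn0 : r != 0 by lra.
  have E z : 0 <= z -> spow r z = z `^ r.
    by move=> z0; rewrite spow_ge0 //; case: eqVneq => // ->; rewrite powR0.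
  rewrite !E //; apply: (@le_trans _ _ (r * x `^ (r - 1) * (x - y))); last first.
    rewrite ler_wpM2r ?subr_ge0 // ler_wpM2l ?ge0_ler_powR ?nnegrE //; lra.
  have [->|rneq] := eqVneq r 1; first by rewrite !powRr1 // subrr powRr0; lra.
  have rgt : 1 < r by rewrite lt_neqAle eq_sym rneq.
  have := powR_norm_tangent y x rgt.
  rewrite !ger0_norm //.
  have -> : spow (r - 1) x = x `^ (r - 1).
    by rewrite spow_ge0 //; case: eqVneq => // ->; rewrite powR0 //; lra.
  lra.
wlog uv : u v / v <= u.
  move=> H um vm; have [/H|/ltW/H] := lerP v u; first exact.
  move=> /(_ vm um); have -> : (v - u) ^+ 2 = (u - v) ^+ 2 by ring.
  by apply: le_trans; rewrite le_eqVlt; apply/orP; left; apply/eqP; ring.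
move=> um vm; rewrite expr2 mulrA ler_wpM2r ?subr_ge0 //.
have [v0|v0] := leP 0 v.
  by apply: pos => //; rewrite (le_trans _ um) // ler_norm.
have [u0|u0] := leP u 0.
  have := pos (- v) (- u); rewrite !spow_opp !opprK oppr_ge0 lerN2.
  rewrite (addrC (- spow r v)) (addrC (- v)); apply => //.
  by rewrite (le_trans _ vm) // -normrN ler_norm.
have m0 : 0 <= m by exact: le_trans um.
have half x : 0 <= x -> x <= m -> spow r x <= r * m `^ (r - 1) * x.
  move=> x0 xm; have := pos x 0 (lexx 0) x0 xm.
  by rewrite subr0 /spow sgr0 mul0r subr0.
have Hu := half u (ltW u0) (le_trans (ler_norm u) um).
have vm' : - v <= m by rewrite (le_trans _ vm) // -normrN ler_norm.
have := half (- v) ltac:(lra) vm'; rewrite spow_opp; lra.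
Qed.

(** The tangent at [a + b] bounds the increment by [q * spow (q - 1) (a + b) * b],
    and the Lipschitz bound replaces [a + b] by [a] in the slope. *)
Lemma powR_norm_smooth q a b : 2 <= q ->
  `|a + b| `^ q <= `|a| `^ q + q * spow (q - 1) a * b
                   + q * (q - 1) * ((`|a| + `|b|) `^ (q - 2) * b ^+ 2).
Proof.
move=> q2; have := @powR_norm_tangent q a (a + b) ltac:(lra).
have := @spow_lipschitz (q - 1) (`|a| + `|b|) (a + b) a ltac:(lra) (ler_normD _ _).
rewrite lerDl normr_ge0 => /(_ isT).
have -> : a + b - a = b by ring.
have -> : a - (a + b) = - b by ring.
have -> : q - 1 - 1 = q - 2 by ring.
have q0 : 0 < q by lra.
move=> lip tan; have {lip} := ler_wpM2l (ltW q0) lip; lra.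
Qed.

End powers.

(** * Finite sums of powers *)

Lemma expR1_le3 (R : realType) : expR 1 <= 3 :> R.
Proof.
have e6 : 5 / 6 <= expR (- 6^-1) :> R by apply: le_trans (expR_ge1Dx _); lra.
have e1 : (5 / 6) ^+ 6 <= expR (- 1) :> R.
  have -> : - 1 = 6%:R * - 6^-1 :> R by field.
  by rewrite expRM_natl lerXn2r // nnegrE ?expR_ge0 //; lra.
have := expR_gt0 (1 : R); have : expR 1 * expR (- 1) = 1 :> R.
  by rewrite -expRD subrr expR0.
nra.
Qed.

Section sums.
Context {R : realType} {I : Type} (r : seq I).
Implicit Types (l q e : R) (a b x y : I -> R).

Lemma sum_vanish x (f : I -> R) : (forall j, 0 <= x j) ->
  (forall j, x j = 0 -> f j = 0) ->
  \sum_(j <- r) x j = 0 -> \sum_(j <- r) f j = 0.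
Proof.
move=> x0 xf; elim: r => [|j s IH]; first by rewrite !big_nil.
rewrite !big_cons => /eqP; rewrite paddr_eq0 ?sumr_ge0 //.
by move=> /andP[/eqP/xf -> /eqP/IH ->]; rewrite addr0.
Qed.

Lemma sum_powR_ge0 q x : 0 <= \sum_(j <- r) x j `^ q.
Proof. by apply: sumr_ge0 => j _; exact: powR_ge0. Qed.

(** Each sum is scaled to one and the weighted arithmetic-geometric inequality
    is summed. The end points [l = 0] and [l = 1] rely on [0 `^ 0 = 1]. *)
Lemma sum_holder l x y : 0 <= l <= 1 -> (forall j, 0 <= x j) ->
  (forall j, 0 <= y j) ->
  \sum_(j <- r) x j `^ l * y j `^ (1 - l)
    <= (\sum_(j <- r) x j) `^ l * (\sum_(j <- r) y j) `^ (1 - l).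
Proof.
move=> /andP[l0 l1] x0 y0; set X := \sum_(j <- r) x j; set Y := \sum_(j <- r) y j.
have X0 : 0 <= X by apply: sumr_ge0.
have Y0 : 0 <= Y by apply: sumr_ge0.
have [->|ln0] := eqVneq l 0.
  rewrite subr0 powRr0 mul1r powRr1 // le_eqVlt; apply/orP; left; apply/eqP.
  by apply: eq_bigr => j _; rewrite powRr0 mul1r powRr1.
have [->|ln1] := eqVneq l 1.
  rewrite subrr powRr0 mulr1 powRr1 // le_eqVlt; apply/orP; left; apply/eqP.
  by apply: eq_bigr => j _; rewrite powRr0 mulr1 powRr1.
have step j : X != 0 -> Y != 0 -> x j `^ l * y j `^ (1 - l) <=
    X `^ l * Y `^ (1 - l) * (l * (x j / X) + (1 - l) * (y j / Y)).
  move=> Xn0 Yn0.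
  have xX : 0 <= x j / X by rewrite divr_ge0.
  have yY : 0 <= y j / Y by rewrite divr_ge0.
  have {1}-> : x j = X * (x j / X) by field.
  have {1}-> : y j = Y * (y j / Y) by field.
  move: (x j / X) (y j / Y) xX yY => u v u0 v0.
  by rewrite !powRM // mulrACA ler_wpM2l ?mulr_ge0 ?powR_ge0 // weighted_amgm ?l0.
have rhs0 : 0 <= X `^ l * Y `^ (1 - l) by rewrite mulr_ge0 ?powR_ge0.
have [Xz|Xn0] := eqVneq X 0.
  by rewrite (sum_vanish x0 _ Xz) // => j ->; rewrite powR0 // mul0r.
have [Yz|Yn0] := eqVneq Y 0.
  rewrite (sum_vanish y0 _ Yz) // => j ->.
  by rewrite powR0 ?mulr0 // subr_eq0 eq_sym.
apply: le_trans (ler_sum _ (fun j _ => step j Xn0 Yn0)) _.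
rewrite -mulr_sumr big_split /= -!mulr_sumr -!mulr_suml -/X -/Y !divff //.
by rewrite !mulr1 subrKC mulr1.
Qed.

(** Minkowski's inequality for vectors of norms at most [1] and [e]:
    [(`|a| + `|b|) / (1 + e)] is the convex combination of [`|a|] and [`|b| / e]
    with weights [1 / (1 + e)] and [e / (1 + e)]. *)
Lemma sum_powR_minkowski q a b e : 1 < q -> 0 < e ->
  \sum_(j <- r) `|a j| `^ q <= 1 -> \sum_(j <- r) `|b j| `^ q <= e `^ q ->
  \sum_(j <- r) (`|a j| + `|b j|) `^ q <= (1 + e) `^ q.
Proof.
move=> q1 e0 a1 be; set l := (1 + e)^-1.
have l1 : (1 + e) * l = 1 by rewrite /l divff // gt_eqF //; lra.
have l0 : 0 < l by rewrite invr_gt0; lra.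
have eq0 : 0 < e `^ q by exact: powR_gt0.
have pw (x y : R) : 0 <= x -> 0 <= y -> (x + y) `^ q <=
    (1 + e) `^ q * (l * x `^ q + (1 - l) * (y `^ q / e `^ q)).
  move=> x0 y0; have z0 := mulr_ge0 (addr_ge0 x0 y0) (ltW l0).
  have e1 : 0 < 1 + e by lra.
  have {1}-> : x + y = (1 + e) * ((x + y) * l) by rewrite mulrCA l1 mulr1.
  rewrite powRM ?(ltW e1) // ler_pM2l ?powR_gt0 //.
  (* Jensen's inequality, from the tangent at the barycentre. *)
  have := powR_norm_tangent x ((x + y) * l) q1.
  have := powR_norm_tangent (y / e) ((x + y) * l) q1.
  rewrite (ger0_norm z0) (ger0_norm x0) (ger0_norm (divr_ge0 y0 (ltW e0))).
  have -> : (y / e) `^ q = y `^ q / e `^ q.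
    by rewrite powRM ?invr_ge0 ?(ltW e0) // powR_invr ?(ltW e0).
  set s := q * spow _ _; set z := _ `^ q; set u := x `^ q; set v := y `^ q / _.
  move=> H1 H2.
  have l1' : 0 <= 1 - l by nra.
  have := lerD (ler_wpM2l (ltW l0) H2) (ler_wpM2l l1' H1).
  apply: le_trans; rewrite le_eqVlt; apply/orP; left; apply/eqP.
  rewrite /l; field; rewrite ?gt_eqF //; lra.
apply: le_trans (ler_sum _ (fun j _ => pw _ _ (normr_ge0 _) (normr_ge0 _))) _.
rewrite -mulr_sumr big_split /= -!mulr_sumr -mulr_suml ler_piMr ?powR_ge0 //.
have l1' : 0 <= 1 - l by nra.
have : (\sum_(j <- r) `|b j| `^ q) / e `^ q <= 1 by rewrite ler_pdivrMr // mul1r.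
nra.
Qed.
End sums.

Section smoothness.
Context {R : realType} {I : Type} (r : seq I) (beta : R).
Hypotheses (b0 : 0 < beta) (b1 : beta <= 1).
Implicit Types (a b : I -> R) (c e : R).
Let q := 2 / beta.
Let p := 2 / (2 - beta).

Let q_facts : [/\ 0 < beta, beta <= 1, 2 <= q, q^-1 = beta / 2 & q * beta = 2].
Proof.
move: b0 b1 => B0 B1; rewrite /q.
by split => //; [rewrite ler_pdivlMr //; lra|field; lra..].
Qed.

Let sum_norm_spow a b e : 0 < e ->
  \sum_(j <- r) `|a j| `^ q <= 1 -> \sum_(j <- r) `|b j| `^ q <= e `^ q ->
  - e <= \sum_(j <- r) spow (q - 1) (a j) * b j.
Proof.
have [B0 B1 q2 qV qb] := q_facts.
move=> e0 a1 be; rewrite -lerN2 opprK -sumrN.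
have l01 : 0 <= q^-1 <= 1 by rewrite qV; lra.
apply: (@le_trans _ _ (\sum_(j <- r)
  (`|b j| `^ q) `^ q^-1 * (`|a j| `^ q) `^ (1 - q^-1))).
  apply: ler_sum => j _; rewrite -!powRrM mulrBr mulr1 divff ?powRr1 //; last lra.
  apply: le_trans (ler_norm _) _; rewrite normrN normrM normr_spow; last lra.
  by rewrite mulrC.
apply: le_trans (sum_holder _ l01 (fun=> powR_ge0 _ _) (fun=> powR_ge0 _ _)) _.
rewrite -[leRHS]mulr1; apply: ler_pM; rewrite ?powR_ge0 //.
  have -> : e = (e `^ q) `^ q^-1.
    by rewrite -powRrM divff ?powRr1 ?(ltW e0) //; lra.
  by apply: powR_homo be; [case/andP: l01|exact: sum_powR_ge0].
have l0 : 0 <= 1 - q^-1 by lra.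
by have := powR_homo l0 (sum_powR_ge0 _ _ _) a1; rewrite powR1.
Qed.

(** Vectors [a] of norm one. For [q * e <= 1] the bound on [`|a + b| `^ q] is
    summed; Hölder's and Minkowski's inequalities bound the second-order term by
    [(1 + e) `^ (q - 2) * e ^+ 2 <= 3 * e ^+ 2], and the power [beta <= 1] is
    replaced by its tangent at one. For [q * e > 1] the terms of first order are
    themselves small: [4 * e <= 4 * q * e ^+ 2 <= 8 * (q - 1) * e ^+ 2]. Minkowski's
    inequality then suffices, and the constant is [9 = 8 + 1]. *)
Let smooth_unit a b e : 0 < e ->
  \sum_(j <- r) `|a j| `^ q = 1 -> \sum_(j <- r) `|b j| `^ q <= e `^ q ->
  (\sum_(j <- r) `|a j + b j| `^ q) `^ beta
    <= 1 + 2 * (\sum_(j <- r) spow (q - 1) (a j) * b j) + 9 * (q - 1) * e ^+ 2.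
Proof.
have [B0 B1 q2 qV qb] := q_facts.
move=> e0 a1 be.
set G := \sum_(j <- r) spow _ _ * _; set S := \sum_(j <- r) `|_ + _| `^ q.
have S0 : 0 <= S by exact: sum_powR_ge0.
have mink : \sum_(j <- r) (`|a j| + `|b j|) `^ q <= (1 + e) `^ q.
  by apply: sum_powR_minkowski; rewrite ?a1 //; lra.
have Ge : - e <= G by apply: sum_norm_spow; rewrite ?a1.
have [qe|qe] := leP (q * e) 1; last first.
  have : S `^ beta <= (1 + e) ^+ 2.
    rewrite -[leRHS]powR_mulrn; last lra.
    rewrite -[X in _ <= _ `^ X]qb powRrM; apply: powR_homo => //; first exact: ltW.
    apply: le_trans mink; apply: ler_sum => j _.
    by apply: powR_homo (ler_normD _ _) => //; lra.
  nra.
apply: le_trans (powR_le_tangent1 _ S0) _; first by lra.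
have {}S0 : S <= 1 + q * G + q * (q - 1) * (3 * e ^+ 2).
  have step j := @powR_norm_smooth R q (a j) (b j) q2.
  apply: le_trans (ler_sum _ (fun j _ => step j)) _.
  rewrite !big_split /= a1 -mulr_sumr lerD //; last first.
    rewrite ler_wpM2l //; first nra.
    have l01 : 0 <= 1 - beta <= 1 by lra.
    apply: (@le_trans _ _ (\sum_(j <- r)
      ((`|a j| + `|b j|) `^ q) `^ (1 - beta) * (`|b j| `^ q) `^ (1 - (1 - beta)))).
      apply: ler_sum => j _; rewrite -!powRrM subKr qb mulrBr mulr1 qb.
      by rewrite powR_mulrn // real_normK // num_real.
    apply: le_trans (sum_holder _ l01 (fun=> powR_ge0 _ _) (fun=> powR_ge0 _ _)) _.
    apply: ler_pM; rewrite ?powR_ge0 //.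
      apply: (@le_trans _ _ (((1 + e) `^ q) `^ (1 - beta))).
        by apply: powR_homo mink; [lra|exact: sum_powR_ge0].
      rewrite -powRrM; apply: le_trans (expR1_le3 R).
      apply: (@le_trans _ _ (expR e `^ (q * (1 - beta)))).
        by apply: powR_homo (expR_ge1Dx _); [nra|lra].
      by rewrite -expRM ler_expR; nra.
    rewrite subKr -[leRHS]powR_mulrn ?(ltW e0) // -[X in _ <= _ `^ X]qb powRrM.
    by apply: powR_homo be; [exact: ltW|exact: sum_powR_ge0].
  by rewrite mulr_sumr; under [X in _ <= _ + X]eq_bigr do rewrite mulrA.
have -> : 1 + 2 * G + 9 * (q - 1) * e ^+ 2
    = 1 + beta * q * G + beta * q * (q - 1) * (3 * e ^+ 2) + 3 * ((q - 1) * e ^+ 2).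
  by rewrite (mulrC beta) qb; ring.
have := ler_wpM2l (ltW b0) S0.
have : 0 <= (q - 1) * e ^+ 2 by rewrite mulr_ge0 ?sqr_ge0 //; lra.
lra.
Qed.

(** As [2 / q = beta], the left-hand side is the squared [q]-norm of [a + b] and
    the second term on the right its directional derivative at [a]. The factor
    [q - 1] of the remainder is what produces the square root of [log_dim] in the
    regret. *)
Lemma sum_powR_smooth a b e : 0 < e -> \sum_(j <- r) `|b j| `^ q <= e `^ q ->
  (\sum_(j <- r) `|a j + b j| `^ q) `^ beta
    <= (\sum_(j <- r) `|a j| `^ q) `^ beta
       + 2 * (\sum_(j <- r) `|a j| `^ q) `^ (beta - 1)
           * (\sum_(j <- r) spow (q - 1) (a j) * b j)
       + 9 * (q - 1) * e ^+ 2.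
Proof.
have [B0 B1 q2 qV qb] := q_facts.
move=> e0 be; set A := \sum_(j <- r) `|a j| `^ q.
have A0 : 0 <= A by exact: sum_powR_ge0.
have [Az|An0] := eqVneq A 0.
  have az j : `|a j| `^ q = 0 -> a j = 0.
    by move/eqP; rewrite powR_eq0 normr_eq0 => /andP[/eqP].
  have gE : \sum_(j <- r) spow (q - 1) (a j) * b j = 0.
    apply: sum_vanish Az => j; first exact: powR_ge0.
    by move/az ->; rewrite /spow sgr0 !mul0r.
  have aE : \sum_(j <- r) `|a j + b j| `^ q = \sum_(j <- r) `|b j| `^ q.
    apply/eqP; rewrite -subr_eq0 -sumrB; apply/eqP.
    apply: sum_vanish Az => j; first exact: powR_ge0.
    by move/az ->; rewrite add0r subrr.
  rewrite aE gE mulr0 addr0 Az powR0 ?gt_eqF // add0r.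
  apply: (@le_trans _ _ ((e `^ q) `^ beta)).
    by apply: powR_homo be; [exact: ltW|exact: sum_powR_ge0].
  by rewrite -powRrM qb powR_mulrn ?(ltW e0) //; nra.
have {}A0 : 0 < A by rewrite lt0r An0.
pose c := A `^ q^-1; have c0 : 0 < c by exact: powR_gt0.
have cq : c `^ q = A by rewrite -powRrM mulVf ?powRr1 ?ltW //; lra.
have c2 : c ^+ 2 = A `^ beta.
  by rewrite -powR_mulrn ?(ltW c0) // -powRrM qV; congr (_ `^ _); lra.
have div u : `|u / c| `^ q = `|u| `^ q / A.
  rewrite normrM normfV (gtr0_norm c0) powRM ?invr_ge0 ?(ltW c0) //.
  by rewrite powR_invr ?(ltW c0) // cq.
(* By homogeneity, [a] may be scaled to norm one. *)
have := @smooth_unit (fun j => a j / c) (fun j => b j / c) (e / c).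
rewrite divr_gt0 // => /(_ isT).
have -> : \sum_(j <- r) `|a j / c| `^ q = 1.
  by under eq_bigr do rewrite div; rewrite -mulr_suml divff.
have -> : (e / c) `^ q = e `^ q / A.
  by rewrite -[in LHS](gtr0_norm (divr_gt0 e0 c0)) div gtr0_norm.
under eq_bigr do rewrite div.
rewrite -mulr_suml ler_pM2r ?invr_gt0 // => /(_ erefl be).
under eq_bigr do rewrite -mulrDl div.
rewrite -mulr_suml; set S := \sum_(j <- r) `|_ + _| `^ q.
have S0 : 0 <= S by exact: sum_powR_ge0.
have -> : (S / A) `^ beta = S `^ beta / c ^+ 2.
  by rewrite powRM ?invr_ge0 ?(ltW A0) // powR_invr ?(ltW A0) // c2.
rewrite ler_pdivrMr ?exprn_gt0 // => /le_trans; apply.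
have E j : spow (q - 1) (a j / c) * (b j / c) = spow (q - 1) (a j) * b j / A.
  rewrite /spow sgrM (gtr0_sg (x := c^-1)) ?invr_gt0 // mulr1.
  rewrite normrM normfV (gtr0_norm c0) powRM ?invr_ge0 ?(ltW c0) //.
  have -> : c^-1 `^ (q - 1) = c / A.
    rewrite powR_invr ?(ltW c0) // powRB ?(gt_eqF c0) ?implybT // cq powRr1 ?(ltW c0) //.
    by rewrite invf_div.
  by field; rewrite ?gt_eqF.
under eq_bigr do rewrite E.
rewrite -mulr_suml -c2.
have -> : A `^ (beta - 1) = c ^+ 2 / A.
  by rewrite powRB ?(gt_eqF A0) ?implybT // powRr1 ?ltW // c2.
by rewrite le_eqVlt; apply/orP; left; apply/eqP; field; rewrite ?gt_eqF.
Qed.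

(** The convex conjugate of [c / 2] times the squared [q]-norm is [(2 * c)^-1]
    times the squared [p]-norm, where [1 / p + 1 / q = 1]. *)
Lemma sum_powR_fenchel_young c a b : 0 < c ->
  \sum_(j <- r) a j * b j
    <= c / 2 * (\sum_(j <- r) `|a j| `^ q) `^ beta
       + (2 * c)^-1 * (\sum_(j <- r) `|b j| `^ p) `^ (2 - beta).
Proof.
have [B0 B1 q2 qV qb] := q_facts.
move=> c0; set A := \sum_(j <- r) `|a j| `^ q; set B := \sum_(j <- r) _ `^ p.
have l01 : 0 <= beta / 2 <= 1 by lra.
have ab : \sum_(j <- r) a j * b j <= A `^ (beta / 2) * B `^ (1 - beta / 2).
  apply: le_trans (sum_holder _ l01 (fun=> powR_ge0 _ _) (fun=> powR_ge0 _ _)).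
  apply: ler_sum => j _; rewrite -!powRrM.
  have -> : q * (beta / 2) = 1 by rewrite mulrA qb; lra.
  have -> : p * (1 - beta / 2) = 1 by rewrite /p; field; lra.
  by rewrite !powRr1 // -normrM ler_norm.
apply: le_trans ab _.
have -> : A `^ beta = (A `^ (beta / 2)) ^+ 2.
  by rewrite -powR_mulrn ?powR_ge0 // -powRrM; congr (_ `^ _); lra.
have -> : B `^ (2 - beta) = (B `^ (1 - beta / 2)) ^+ 2.
  by rewrite -powR_mulrn ?powR_ge0 // -powRrM; congr (_ `^ _); lra.
move: (A `^ _) (B `^ _) => x y.
rewrite -subr_ge0 (_ : _ - _ = (c * x - y) ^+ 2 / (2 * c)).
  by rewrite divr_ge0 ?sqr_ge0 // mulr_ge0 ?ltW.
by field; rewrite gt_eqF.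
Qed.

(** Here [b] is the gradient at [a] of [c / 2] times the squared [q]-norm. The two
    equations make [a] and [b] an equality case of the preceding inequality. *)
Lemma sum_powR_fenchel_eq c a : 0 < c ->
  let A := \sum_(j <- r) `|a j| `^ q in
  let b j := c * A `^ (beta - 1) * spow (q - 1) (a j) in
  (\sum_(j <- r) a j * b j = c * A `^ beta) /\
  ((\sum_(j <- r) `|b j| `^ p) `^ (2 - beta) = c ^+ 2 * A `^ beta).
Proof.
have [B0 B1 q2 qV qb] := q_facts.
move=> c0 A b; have A0 : 0 <= A by exact: sum_powR_ge0.
have AE : A `^ (beta - 1) * A = A `^ beta.
  rewrite -[X in _ * X]powRr1 // -powRD; first by rewrite subrK.
  by rewrite subrK gt_eqF.
split.
  have E j : a j * b j = c * A `^ (beta - 1) * `|a j| `^ q.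
    by rewrite /b mulrCA (mulrC (a j)) spow_mul //; lra.
  under eq_bigr do rewrite E.
  by rewrite -mulr_sumr -mulrA AE.
have E j : `|b j| `^ p = (c * A `^ (beta - 1)) `^ p * `|a j| `^ q.
  rewrite /b normrM [LHS]powRM ?normr_ge0 // ger0_norm ?mulr_ge0 ?powR_ge0 ?(ltW c0) //.
  congr (_ * _); rewrite normr_spow; last lra.
  rewrite -powRrM; congr (_ `^ _).
  by rewrite /p /q; field; rewrite gt_eqF //=; lra.
under eq_bigr do rewrite E.
rewrite -mulr_sumr powRM ?powR_ge0 // -powRrM.
have -> : p * (2 - beta) = 2 by rewrite /p; field; lra.
rewrite powR_mulrn ?mulr_ge0 ?powR_ge0 ?(ltW c0) // exprMn -mulrA; congr (_ * _).
rewrite -powR_mulrn ?powR_ge0 // -powRrM -powRD.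
  by congr (_ `^ _); lra.
by apply/implyP => /eqP; lra.
Qed.

End smoothness.

(** * Derivability of powers *)

Section derivability.
Context {R : realType}.

Lemma derivable_powR_norm (s x : R) : 1 < s ->
  derivable (fun u : R => `|u| `^ s) x 1.
Proof.
move=> s1; have s0 : 0 < s - 1 by lra.
have [xneg|xpos|->] := ltgtP x 0.
- apply: (@near_eq_derivable _ _ _ (fun u => (- u) `^ s)).
    near=> u; rewrite ler0_norm //; near: u.
    by apply: filterS (lt_nbhsl xneg) => u /ltW.
  apply/derivable1_diffP.
  apply: (@differentiable_comp _ _ _ _ (fun u : R => - u) (fun v : R => v `^ s)) => //.
  by apply/derivable1_diffP/derivable_powR; rewrite in_itv /= andbT oppr_gt0.
- apply: (@near_eq_derivable _ _ _ (fun u => u `^ s)).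
    near=> u; rewrite ger0_norm //; near: u.
    by apply: filterS (lt_nbhsr xpos) => u /ltW.
  by apply/derivable_powR; rewrite in_itv /= andbT.
- apply/cvg_ex; exists 0; apply/cvgr0Pnorm_lt => e e0.
  near=> h; have h0 : h != 0 by near: h; exact: nbhs_dnbhs_neq.
  rewrite normr0 powR0 ?subr0; last lra.
  rewrite /= ?addr0 /GRing.scale /= mulr1 normrM normfV.
  rewrite (ger0_norm (powR_ge0 _ _)) -mulr_powRB1 ?mulKf ?normr_eq0 //; last lra.
  have -> : e = (e `^ (s - 1)^-1) `^ (s - 1).
    by rewrite -powRrM mulVf ?gt_eqF // powRr1 // ltW.
  apply: gt0_ltr_powR; rewrite ?nnegrE ?powR_ge0 //.
  near: h; apply: nbhs_dnbhs; apply: (@nbhs0_lt R R).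
  exact: powR_gt0.
Unshelve. all: by end_near. Qed.

Lemma derivable_sum_seq (I : Type) (r : seq I) (f : I -> R -> R) (t : R) :
  (forall j, derivable (f j) t 1) -> derivable (fun u => \sum_(j <- r) f j u) t 1.
Proof.
move=> df; elim: r => [|j s IH].
  rewrite (_ : (fun u => _) = cst 0); first exact: derivable_cst.
  by apply/funext => u; rewrite big_nil.
rewrite (_ : (fun u => _) = f j \+ (fun u => \sum_(i <- s) f i u)).
  exact: derivableD.
by apply/funext => u; rewrite big_cons.
Qed.

Lemma derivable_powR_affine (s u v t : R) : 1 < s ->
  derivable (fun t : R => `|u + t * v| `^ s) t 1.
Proof.
move=> s1; apply/derivable1_diffP.
apply: (@differentiable_comp _ _ _ _ (fun t : R => u + t * v) (fun z : R => `|z| `^ s)).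
  by apply/derivable1_diffP.
by apply/derivable1_diffP/derivable_powR_norm.
Qed.

(** For [s = 1] the power disappears; for [s > 1] it may be replaced by the power of
    an absolute value, which is derivable at zero too. Hence zeros of [f] are
    allowed. *)
Lemma derivable_powR_ge0 (f : R -> R) (s x : R) : 1 <= s -> (forall u, 0 <= f u) ->
  derivable f x 1 -> derivable (fun u => f u `^ s) x 1.
Proof.
move=> s1 f0 df; have [->|sn1] := eqVneq s 1.
  by under eq_fun do rewrite powRr1 //.
have -> : (fun u => f u `^ s) = (fun v => `|v| `^ s) \o f.
  by apply/funext => u /=; rewrite ger0_norm.
apply/derivable1_diffP; apply: differentiable_comp; first exact/derivable1_diffP.
by apply/derivable1_diffP/derivable_powR_norm; rewrite lt_neqAle eq_sym sn1.
Qed.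

(** A function minus a supporting line is minimal at the point of contact. This
    computes a derivative from mere derivability and a convexity inequality. *)
Lemma derive1_supporting_line (f : R -> R) (L : R) :
  (forall t, derivable f t 1) -> (forall t, f 0 + t * L <= f t) ->
  derive1 f 0 = L.
Proof.
move=> df fL; have dl t : derivable (fun t : R => t * L) t 1 by [].
have : is_derive (0 : R) 1 (f - (fun t => t * L)) 0.
  apply: (@derive1_at_min _ _ (-1) 1).
  - by rewrite (@le_trans _ _ 0) // lerN10.
  - by move=> t _; apply: derivableB.
  - by rewrite in_itv /= ltrN10 ltr01.
  - by move=> t _; rewrite !fctE mul0r subr0; have := fL t; lra.
case=> _; rewrite deriveB // => /eqP; rewrite subr_eq0 => /eqP.
rewrite derive1E => ->.
by rewrite -derive1E derive1Mr // derive1_id mul1r.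
Qed.

End derivability.

(** * Finitely supported vectors *)

Section finite_support.
Context {R : realType} {n : option nat}.
Local Notation E := (axis n -> R).
Implicit Types (x y g theta f : E) (r : seq (axis n)).

(** A list containing the support rather than the support itself, so that several
    vectors can share it. *)
Definition supported r f := forall j, j \notin r -> f j = 0.

Lemma finite_supported f : finite_set [set j | f j != 0] ->
  exists2 r, uniq r & supported r f.
Proof.
move=> /finite_seqP[s sE]; exists (undup s); first exact: undup_uniq.
move=> j; rewrite mem_undup; apply: contraNeq => fj.
by have : [set j | f j != 0] j by []; rewrite sE.
Qed.

Lemma supported_finite r f : supported r f -> finite_set [set j | f j != 0].
Proof.
move=> rf; apply: (@sub_finite_set _ _ [set` r]) => // j /= fj.
by apply: contraNT fj => /rf ->.
Qed.

Lemma fsum_seq r f : uniq r -> supported r f ->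
  \sum_(j \in [set: axis n]) f j = \sum_(j <- r) f j.
Proof.
move=> ur rf; rewrite (fsbigE r) //.
  by apply: eq_bigl => j; rewrite in_setT.
by move=> j _ /rf.
Qed.

Lemma pairing_seq r g x : uniq r -> supported r g ->
  pairing g x = \sum_(j <- r) g j * x j.
Proof. by move=> ur rg; rewrite /pairing (fsum_seq ur) // => j /rg ->; rewrite mul0r. Qed.

Lemma finite_supported2 f g : finite_set [set j | f j != 0] ->
  finite_set [set j | g j != 0] ->
  exists r, [/\ uniq r, supported r f & supported r g].
Proof.
move=> /finite_supported[r ur rf] /finite_supported[s us sg].
exists (undup (r ++ s)); split; rewrite ?undup_uniq //.
  by move=> j; rewrite mem_undup mem_cat negb_or => /andP[/rf].
by move=> j; rewrite mem_undup mem_cat negb_or => /andP[_ /sg].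
Qed.

Lemma esum_split r f : uniq r -> (forall j, 0 <= f j) ->
  \esum_(j in [set: axis n]) (f j)%:E
    = ((\sum_(j <- r) f j)%:E + \esum_(j in ~` [set` r]) (f j)%:E)%E.
Proof.
move=> ur f0; rewrite (esumID [set` r]) ?setTI => [|j _]; last by rewrite lee_fin.
rewrite esum_fset //; last by move=> j _; rewrite lee_fin.
by rewrite -fsbig_seq // sumEFin.
Qed.

Lemma esum_le_seq f (c : \bar R) :
  (forall r, uniq r -> (\sum_(j <- r) f j)%:E <= c)%E ->
  (\esum_(j in [set: axis n]) (f j)%:E <= c)%E.
Proof.
move=> fc; apply: ge_ereal_sup => _ [A [fA _] <-].
move/finite_seqP: fA => [s sA].
have -> : A = [set` undup s].
  by rewrite sA; apply/seteqP; split => j /=; rewrite mem_undup.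
by rewrite -fsbig_seq ?undup_uniq // sumEFin fc ?undup_uniq.
Qed.

Lemma ler_sum_esum r f (c : R) : uniq r -> (forall j, 0 <= f j) ->
  (\esum_(j in [set: axis n]) (f j)%:E <= c%:E)%E -> \sum_(j <- r) f j <= c.
Proof.
move=> ur f0 fc; rewrite -lee_fin (le_trans _ fc) // (esum_split ur f0).
by rewrite leeDl // esum_ge0 // => j _; rewrite lee_fin.
Qed.

Lemma pos_gt0 (j : axis n) : (0 < pos j)%N.
Proof. by case: n j => [m|] j. Qed.

Lemma pos_inj : injective (@pos n).
Proof. by case: n => [m|] i j /= [] // /val_inj. Qed.

(** The partial sums [\sum_(1 <= i < k.+2) 1 / i ^ 2] telescope to at most
    [2 - 1 / k.+1]. *)
Lemma sum_pos_inv_sqr r : uniq r -> \sum_(j <- r) ((pos j)%:R ^+ 2)^-1 <= 2 :> R.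
Proof.
move=> ur; pose m := (\max_(j <- r) pos j)%N; pose s := map (@pos n) r.
have us : uniq s by rewrite map_inj_uniq //; exact: pos_inj.
have s_le : {subset s <= index_iota 1 m.+2}.
  move=> _ /mapP[j jr ->]; rewrite mem_index_iota pos_gt0 /= ltnS leqW //.
  by rewrite /m (big_rem j) //= leq_maxl.
have tel k : \sum_(1 <= i < k.+2) (i%:R ^+ 2)^-1 <= 2 - k.+1%:R^-1 :> R.
  elim: k => [|k IH]; first by rewrite big_nat1; lra.
  rewrite big_nat_recr //=; have k0 : 0 < k.+1%:R :> R by rewrite ltr0n.
  apply: le_trans (lerD IH (lexx _)) _; rewrite -[k.+2]addn1 natrD.
  rewrite -addrA lerD2l -lerBrDl opprK addrC -subr_ge0.
  set x := k.+1%:R in k0 *.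
  rewrite (_ : _ - _ = (x * (x + 1) ^+ 2)^-1).
    by rewrite invr_ge0 mulr_ge0 ?sqr_ge0 // ltW.
  by field; rewrite !gt_eqF //; lra.
rewrite -(big_map (@pos n) xpredT (fun i => (i%:R ^+ 2)^-1)) -/s.
have sE : perm_eq s [seq i <- index_iota 1 m.+2 | i \in s].
  apply: uniq_perm; rewrite ?filter_uniq ?iota_uniq // => i.
  by rewrite mem_filter; case: (boolP (i \in s)) => // /s_le ->.
rewrite (perm_big _ sE) big_filter big_mkcond /=; apply: (@le_trans _ _ (2 - m.+1%:R^-1)).
  by apply: le_trans (tel m); apply: ler_sum => i _; case: ifP.
by rewrite gerDl oppr_le0.
Qed.

End finite_support.

(** * The mirror map and its potential *)

Section mirror_map.
Context {R : realType} {n : option nat} (beta : R).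
Local Notation E := (axis n -> R).
Implicit Types (x y g v theta : E) (r : seq (axis n)) (t T : R).

Definition unweight theta : E := fun j => theta j / (pos j)%:R `^ beta.

Definition dual_sum theta : R :=
  \sum_(j \in [set: axis n]) `|unweight theta j| `^ (2 / beta).

(** The convex conjugate of [dist_gen]: it is [(p - 1) / 2] times the squared
    [q]-norm of [unweight theta], with [p - 1 = beta / (2 - beta)], [q = 2 / beta]
    and thus [2 / q = beta]. *)
Definition dual_gen theta : R := beta / (2 - beta) / 2 * dual_sum theta `^ beta.

(** The gradient of [dual_gen]. It turns dual iterates into primal ones. *)
Definition mirror_map theta : E :=
  unweight (fun j => beta / (2 - beta) * dual_sum theta `^ (beta - 1)
                     * spow (2 / beta - 1) (unweight theta j)).

Hypotheses (b0 : 0 < beta) (b1 : beta <= 1).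
Let q := 2 / beta.
Let p := 2 / (2 - beta).
Let c := beta / (2 - beta).
Local Notation w := (weight beta).
Local Notation h := (dist_gen beta p).

Let facts : [/\ 0 < beta, beta <= 1, 0 < c, 1 < p & 2 <= q].
Proof.
move: b0 b1 => B0 B1; split => //; first by rewrite /c divr_gt0 //; lra.
  by rewrite /p ltr_pdivlMr //; lra.
by rewrite /q ler_pdivlMr //; lra.
Qed.

Let cE : p - 1 = c.
Proof. by have [B0 B1 _ _ _] := facts; rewrite /p /c; field; lra. Qed.

Let wgt_gt0 (j : axis n) : 0 < (pos j)%:R `^ beta.
Proof. by rewrite powR_gt0 // ltr0n pos_gt0. Qed.

Let wgt_ge1 (j : axis n) : 1 <= (pos j)%:R `^ beta.
Proof. by rewrite -[leLHS](powRr0 (pos j)%:R) ler_powR ?ler1n ?pos_gt0 ?ltW. Qed.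

Lemma supported_unweight r theta : supported r theta -> supported r (unweight theta).
Proof. by move=> rt j /rt; rewrite /unweight => ->; rewrite mul0r. Qed.

Lemma weightK j x : w (unweight x) j = x j.
Proof. by rewrite /weight /unweight mulrC divfK // gt_eqF. Qed.

Lemma unweight_weight theta x j : unweight theta j * w x j = theta j * x j.
Proof. by rewrite /weight /unweight mulrA divfK // gt_eqF. Qed.

Lemma weight_mirror_map theta j : w (mirror_map theta) j =
  c * dual_sum theta `^ (beta - 1) * spow (q - 1) (unweight theta j).
Proof. exact: weightK. Qed.

Lemma supported_mirror_map r theta : supported r theta -> supported r (mirror_map theta).
Proof.
move=> /supported_unweight rt; apply: supported_unweight => j /rt ->.
by rewrite /spow sgr0 !mul0r mulr0.
Qed.

Lemma dual_sum_seq r theta : uniq r -> supported r theta ->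
  dual_sum theta = \sum_(j <- r) `|unweight theta j| `^ q.
Proof.
move=> ur /supported_unweight rt; apply: fsum_seq => // j /rt ->.
have [_ _ _ _ q2] := facts.
by rewrite normr0 powR0 //; move: q2; rewrite /q; lra.
Qed.

Lemma dual_gen0 : dual_gen 0 = 0.
Proof.
have r0 : supported [::] (0 : E) by [].
by rewrite /dual_gen (dual_sum_seq (r := [::])) // big_nil powR0 ?gt_eqF ?mulr0.
Qed.

Lemma dist_gen_fin x T :
  \esum_(j in [set: axis n]) (`|w x j| `^ p)%:E = T%:E ->
  h x = ((2 * c)^-1 * T `^ (2 - beta))%:E.
Proof.
move=> xT; have [B0 B1 _ p1 _] := facts.
have T0 : 0 <= T by rewrite -lee_fin -xT esum_ge0 // => j _; rewrite lee_fin powR_ge0.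
rewrite /dist_gen /normp xT poweR_EFin -EFin_expe -EFinM cE; congr EFin; congr (_ * _).
rewrite -powR_mulrn ?powR_ge0 // -powRrM; congr (_ `^ _).
by clear xT; rewrite /p; field; lra.
Qed.

Lemma dist_gen_infty x :
  \esum_(j in [set: axis n]) (`|w x j| `^ p)%:E = +oo%E -> h x = +oo%E.
Proof.
have [B0 B1 c0 p1 _] := facts => xT.
have p0 : p != 0 by rewrite gt_eqF //; clear xT; lra.
rewrite /dist_gen /normp xT poweRyr ?invr_eq0 // expe2 mulyy gt0_muley //.
by rewrite lte_fin invr_gt0 cE mulr_gt0.
Qed.

Lemma supported_powsum r x : uniq r -> supported r x ->
  \esum_(j in [set: axis n]) (`|w x j| `^ p)%:E = (\sum_(j <- r) `|w x j| `^ p)%:E.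
Proof.
have [B0 B1 c0 p1 _] := facts; move=> ur rx.
rewrite (esum_split ur) => [|j]; last exact: powR_ge0.
rewrite esum1 ?adde0 // => j /= jr; rewrite /weight rx; last exact/negP.
by rewrite mulr0 normr0 powR0 //; lra.
Qed.

Lemma dist_gen_supported r x : uniq r -> supported r x ->
  h x = ((2 * c)^-1 * (\sum_(j <- r) `|w x j| `^ p) `^ (2 - beta))%:E.
Proof. by move=> ur rx; apply: dist_gen_fin; exact: supported_powsum. Qed.

Lemma dual_gen_pairing_le r theta x T : uniq r -> supported r theta ->
  \sum_(j <- r) `|w x j| `^ p <= T ->
  pairing theta x <= dual_gen theta + (2 * c)^-1 * T `^ (2 - beta).
Proof.
move=> ur rt xT; have [B0 B1 c0 p1 _] := facts.
rewrite (pairing_seq _ ur rt); under eq_bigr do rewrite -unweight_weight.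
apply: le_trans (sum_powR_fenchel_young r B0 B1 _ _ c0) _.
rewrite /dual_gen (dual_sum_seq ur rt) lerD2l ler_wpM2l //.
  by rewrite invr_ge0 mulr_ge0 // ltW.
by apply: powR_homo => //; [lra|exact: sum_powR_ge0].
Qed.

Lemma mirror_map_eq theta : finite_set [set j | theta j != 0] ->
  h (mirror_map theta) = (dual_gen theta)%:E /\
  pairing theta (mirror_map theta) = 2 * dual_gen theta.
Proof.
move=> /finite_supported[r ur rt]; have [B0 B1 c0 p1 _] := facts.
have [e1 e2] := sum_powR_fenchel_eq r B0 B1 (unweight theta) c0.
rewrite (dist_gen_supported ur (supported_mirror_map rt)) (pairing_seq _ ur rt).
have eh j : w (mirror_map theta) j =
    c * (\sum_(j <- r) `|unweight theta j| `^ q) `^ (beta - 1)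
      * spow (q - 1) (unweight theta j).
  by rewrite weight_mirror_map (dual_sum_seq ur rt).
rewrite /dual_gen (dual_sum_seq ur rt) -/c.
split.
  rewrite (eq_bigr _ (fun j _ => congr1 (fun u => `|u| `^ p) (eh j))).
  by rewrite e2; congr EFin; field; rewrite gt_eqF.
rewrite (eq_bigr _ (fun j _ => esym (unweight_weight theta (mirror_map theta) j))).
rewrite (eq_bigr _ (fun j _ => congr1 ( *%R (unweight theta j)) (eh j))).
by rewrite e1; field.
Qed.

(** The factor [p - 1] in [dual_gen] compensates the factor [q - 1] in the
    smoothness of the squared norm, since [(p - 1) * (q - 1) = 1]. *)
Lemma dual_gen_smooth theta v e : 0 < e ->
  finite_set [set j | theta j != 0] -> finite_set [set j | v j != 0] ->
  dual_sum v <= e `^ q ->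
  dual_gen (theta + v)
    <= dual_gen theta + pairing v (mirror_map theta) + 9 / 2 * e ^+ 2.
Proof.
move=> e0 ft fv; have [r [ur rt rv]] := finite_supported2 ft fv.
have [B0 B1 c0 p1 q2] := facts.
rewrite (dual_sum_seq ur rv) => ve.
have := sum_powR_smooth B0 B1 (unweight theta) e0 ve.
have rtv : supported r (theta + v) by move=> j jr; rewrite fctE rt ?rv ?addr0.
rewrite /dual_gen (dual_sum_seq ur rt) (dual_sum_seq ur rtv) (pairing_seq _ ur rv).
have -> : \sum_(j <- r) `|unweight (theta + v) j| `^ q =
    \sum_(j <- r) `|unweight theta j + unweight v j| `^ q.
  by apply: eq_bigr => j _; rewrite /unweight mulrDl.
set A := \sum_(j <- r) `|unweight theta j| `^ q.
have -> : \sum_(j <- r) v j * mirror_map theta j = c * (A `^ (beta - 1) *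
    \sum_(j <- r) spow (2 / beta - 1) (unweight theta j) * unweight v j).
  rewrite !mulr_sumr; apply: eq_bigr => j _.
  by rewrite /mirror_map {1}/unweight (dual_sum_seq ur rt) /unweight -/A -/c; ring.
rewrite -/c -/q; move: (A `^ _) (A `^ (beta - 1)) (\sum_(j <- r) _ * _) => ? ? ?.
have cq : c * (q - 1) = 1 by rewrite /c /q; field; lra.
have c2 : 0 <= c / 2 by lra.
move=> /(ler_wpM2l c2) /le_trans; apply.
rewrite le_eqVlt; apply/orP; left; apply/eqP.
rewrite !mulrDr; congr (_ + _ + _); first by field.
rewrite (_ : 9 / 2 * _ = 9 / 2 * (c * (q - 1)) * e ^+ 2); last by rewrite cq mulr1.
by field.
Qed.

(** A point [x] with equality in the Fenchel-Young inequality is a subgradient of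
    [dual_gen] at [theta]. Smoothness in every coordinate direction leaves only the
    gradient. *)
Lemma mirror_map_unique theta x T : finite_set [set j | theta j != 0] ->
  \esum_(j in [set: axis n]) (`|w x j| `^ p)%:E = T%:E ->
  dual_gen theta + (2 * c)^-1 * T `^ (2 - beta) <= pairing theta x ->
  x = mirror_map theta.
Proof.
move=> ft xT tx; apply/funext => j; have [B0 B1 c0 p1 q2] := facts.
pose d := x j - mirror_map theta j; apply/eqP; rewrite -subr_eq0 -/d.
apply/negPn/negP => dn0.
(* The step [d / 9] minimizes [9 / 2 * s ^+ 2 - s * d] over [s]. *)
pose v : E := fun i => if i == j then d / 9 else 0.
have sv : supported [:: j] v.
  by move=> i; rewrite inE /v => /negPf ->.
have fv := supported_finite sv.
have pv y : pairing v y = d / 9 * y j.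
  by rewrite (pairing_seq _ _ sv) // big_seq1 /v eqxx.
have e0 : 0 < `|d / 9| by rewrite normr_gt0 mulf_neq0.
have := dual_gen_smooth e0 ft fv.
rewrite (dual_sum_seq _ sv) // big_seq1.
have -> : `|unweight v j| `^ q <= `|d / 9| `^ q.
  apply: powR_homo => //; first lra.
  rewrite /unweight /v eqxx normrM ler_piMr // normfV ger0_norm ?(ltW (wgt_gt0 _)) //.
  by rewrite invf_le1 ?wgt_ge1.
move=> /(_ isT).
have [r [ur rt rv]] := finite_supported2 ft fv.
have rtv : supported r (theta + v) by move=> i ir; rewrite fctE rt ?rv ?addr0.
have := @dual_gen_pairing_le r (theta + v) x T ur rtv.
have -> : \sum_(j <- r) `|w x j| `^ p <= T.
  by apply: (ler_sum_esum ur) => [i|]; rewrite ?powR_ge0 // xT.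
move=> /(_ isT).
have -> : pairing (theta + v) x = pairing theta x + pairing v x.
  rewrite !(pairing_seq _ ur) // -big_split /=.
  by apply: eq_bigr => i _; rewrite fctE mulrDl.
rewrite !pv real_normK ?num_real //.
have d2 : 0 < d ^+ 2 by rewrite exprn_even_gt0.
have -> : x j = mirror_map theta j + d by rewrite /d addrC subrK.
clear xT; move: tx d2; rewrite -/c.
move: (dual_gen (theta + v)) (dual_gen theta) => ? ?.
move: (pairing theta x) (mirror_map theta j) => *; lra.
Qed.

End mirror_map.

(** * One step of mirror descent *)

Lemma esumZl {R : realType} {I : choiceType} (D : set I) (f : I -> \bar R) (a : R) :
  0 <= a -> (forall j, 0 <= f j)%E ->
  \esum_(j in D) (a%:E * f j)%E = (a%:E * \esum_(j in D) f j)%E.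
Proof.
move=> a0 f0; rewrite /esum -ereal_supZl //; last first.
  by apply/set0P; exists 0%E, set0; [exact: fsets_set0|rewrite fsbig_set0].
rewrite image_comp; congr ereal_sup; apply: eq_imagel => A _ /=.
by rewrite ge0_mule_fsumr.
Qed.

Section mirror_step.
Context {R : realType} {n : option nat} (beta : R).
Local Notation E := (axis n -> R).
Implicit Types (x y g v theta : E) (r : seq (axis n)) (alpha t T : R).
Hypotheses (b0 : 0 < beta) (b1 : beta <= 1).
Let p := 2 / (2 - beta).
Let c := beta / (2 - beta).
Local Notation w := (weight beta).
Local Notation h := (dist_gen beta p).
Local Notation powsum x := (\esum_(j in [set: axis n]) (`|w x j| `^ p)%:E).

Let facts : [/\ 0 < beta, beta <= 1, 0 < c & 1 < p].
Proof.
move: b0 b1 => B0 B1; split => //; first by rewrite /c divr_gt0 //; lra.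
by rewrite /p ltr_pdivlMr //; lra.
Qed.

Lemma sum_le_powsum r x T : uniq r -> powsum x = T%:E ->
  \sum_(j <- r) `|w x j| `^ p <= T.
Proof. by move=> ur xT; apply: (ler_sum_esum ur) => [j|]; rewrite ?powR_ge0 // xT. Qed.

Lemma powsum_cases x : (exists T, powsum x = T%:E) \/ h x = +oo%E.
Proof.
case e : (powsum x) => [T||]; [by left; exists T|by right; exact: dist_gen_infty|].
have : (0 <= powsum x)%E by apply: esum_ge0 => j _; rewrite lee_fin powR_ge0.
by rewrite e.
Qed.

Lemma dist_gen_fenchel_young theta x T : finite_set [set j | theta j != 0] ->
  powsum x = T%:E ->
  pairing theta x <= dual_gen beta theta + (2 * c)^-1 * T `^ (2 - beta).
Proof.
move=> /finite_supported[r ur rt] xT.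
by apply: (dual_gen_pairing_le b0 b1 ur rt); exact: sum_le_powsum.
Qed.

(** As [y] has finite support, the part of [y + t *: (x - y)] outside the support
    contributes [`|t| `^ p] times a constant to the power sum, so the function is
    derivable although [x] may have infinite support. The Fenchel-Young inequality
    with equality at [y] gives a supporting line of slope
    [pairing theta (x - y)]. *)
Lemma derive_dist_gen theta x T : finite_set [set j | theta j != 0] ->
  powsum x = T%:E ->
  let y := mirror_map beta theta in
  derive1 (fun t : R => fine (h (y + t *: (x - y)))) 0 = pairing theta (x - y).
Proof.
move=> ft xT y; have [B0 B1 c0 p1] := facts.
have [r ur rt] := finite_supported ft.
have ry : supported r y by apply: supported_mirror_map.
have : (0 <= \esum_(j in ~` [set` r]) (`|w x j| `^ p)%:E)%E.
  by apply: esum_ge0 => j _; rewrite lee_fin powR_ge0.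
move: xT; rewrite (esum_split ur) => [|j]; last exact: powR_ge0.
case e : (\esum_(j in ~` _) _) => [T'||] // _; rewrite lee_fin => T'0.
pose K t := \sum_(j <- r) `|w y j + t * w (x - y) j| `^ p + `|0 + t * 1| `^ p * T'.
have K0 t : 0 <= K t by rewrite addr_ge0 ?sum_powR_ge0 // mulr_ge0 ?powR_ge0.
have uK t : powsum (y + t *: (x - y)) = (K t)%:E.
  rewrite (esum_split ur) => [|j]; last exact: powR_ge0.
  rewrite /K EFinD; congr (_ + _)%E.
    congr EFin; apply: eq_bigr => j _; congr (`|_| `^ _).
    by rewrite /weight !fctE /GRing.scale /=; ring.
  transitivity (\esum_(j in ~` [set` r]) ((`|0 + t * 1| `^ p)%:E * (`|w x j| `^ p)%:E))%E.
    apply: eq_esum => j /= /negP jr; rewrite -EFinM; congr EFin.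
    rewrite /weight !fctE ry // !add0r subr0 mulr1 -powRM // -normrM.
    by congr (`|_| `^ _); rewrite mulrCA.
  by rewrite esumZl ?powR_ge0 // e -EFinM.
have fK t : fine (h (y + t *: (x - y))) = (2 * c)^-1 * K t `^ (2 - beta).
  by rewrite (dist_gen_fin b0 b1 (uK t)).
apply: derive1_supporting_line => t.
  under eq_fun do rewrite fK.
  apply: derivableM => //; apply: derivable_powR_ge0 => //; first lra.
  apply: derivableD; first by apply: derivable_sum_seq => j; exact: derivable_powR_affine.
  by apply: derivableM => //; exact: derivable_powR_affine.
have [hy ty] := mirror_map_eq b0 b1 ft.
rewrite {1}scale0r addr0 hy /= fK.
have := dist_gen_fenchel_young ft (uK t).
have -> : pairing theta (y + t *: (x - y)) = pairing theta y + t * pairing theta (x - y).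
  rewrite !(pairing_seq _ ur rt) mulr_sumr -big_split /=.
  by apply: eq_bigr => j _; rewrite !fctE /GRing.scale /=; ring.
rewrite ty; lra.
Qed.

Lemma bregman_mirror_map theta x T : finite_set [set j | theta j != 0] ->
  powsum x = T%:E -> bregman h x (mirror_map beta theta) =
    ((2 * c)^-1 * T `^ (2 - beta) - pairing theta x + dual_gen beta theta)%:E.
Proof.
move=> ft xT; rewrite /bregman (derive_dist_gen ft xT) (dist_gen_fin b0 b1 xT).
have [hy ty] := mirror_map_eq b0 b1 ft; rewrite hy -!EFinB; congr EFin.
have [r ur rt] := finite_supported ft.
have -> : pairing theta (x - mirror_map beta theta) =
    pairing theta x - pairing theta (mirror_map beta theta).
  rewrite !(pairing_seq _ ur rt) -sumrB.
  by apply: eq_bigr => j _; rewrite !fctE mulrBr.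
by rewrite ty -/c; ring.
Qed.

Lemma bregman_infty theta x : finite_set [set j | theta j != 0] ->
  h x = +oo%E -> bregman h x (mirror_map beta theta) = +oo%E.
Proof. by move=> ft xy; rewrite /bregman xy (mirror_map_eq b0 b1 ft).1. Qed.

Lemma pairing_dual_step theta g alpha x : finite_set [set j | theta j != 0] ->
  finite_set [set j | g j != 0] ->
  pairing (theta - alpha *: g) x = pairing theta x - alpha * pairing g x.
Proof.
move=> ft fg; have [r [ur rt rg]] := finite_supported2 ft fg.
have rd : supported r (theta - alpha *: g).
  by move=> j jr; rewrite !fctE rt ?rg // scaler0 subr0.
rewrite !(pairing_seq _ ur) // mulr_sumr -sumrB.
by apply: eq_bigr => j _; rewrite !fctE /GRing.scale /=; ring.
Qed.

(** Up to a positive factor and a constant, a step of mirror descent minimizes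
    [h x - pairing (theta - alpha *: g) x]: this is the Fenchel-Young gap at the
    dual point [theta - alpha *: g]. *)
Lemma mirror_objE theta g x T alpha : 0 < alpha ->
  finite_set [set j | theta j != 0] -> finite_set [set j | g j != 0] ->
  powsum x = T%:E ->
  mirror_obj h alpha g (mirror_map beta theta) x =
    (alpha^-1 * ((2 * c)^-1 * T `^ (2 - beta)
       - pairing (theta - alpha *: g) x + dual_gen beta theta))%:E.
Proof.
move=> a0 ft fg xT; rewrite /mirror_obj (bregman_mirror_map ft xT).
rewrite -EFinM -EFinD; congr EFin.
rewrite pairing_dual_step //; clear xT.
by move: ((2 * c)^-1 * _) => z; field; rewrite gt_eqF.
Qed.

Lemma mirror_obj_infty theta g x alpha : 0 < alpha ->
  finite_set [set j | theta j != 0] -> h x = +oo%E ->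
  mirror_obj h alpha g (mirror_map beta theta) x = +oo%E.
Proof.
move=> a0 ft xy; rewrite /mirror_obj (bregman_infty ft xy).
by rewrite gt0_muley ?lte_fin ?invr_gt0.
Qed.

Lemma finite_dual_step theta g alpha : finite_set [set j | theta j != 0] ->
  finite_set [set j | g j != 0] ->
  finite_set [set j | (theta - alpha *: g) j != 0].
Proof.
move=> ft fg; have [r [ur rt rg]] := finite_supported2 ft fg.
apply: (@supported_finite _ _ r) => j jr.
by rewrite !fctE rt ?rg // scaler0 subr0.
Qed.

Lemma powsum_mirror_map theta : finite_set [set j | theta j != 0] ->
  exists T, powsum (mirror_map beta theta) = T%:E.
Proof.
move=> /finite_supported[r ur rt].
by eexists; apply: (supported_powsum b0 b1 ur); apply: supported_mirror_map.
Qed.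

Lemma mirror_obj_mirror_map theta g alpha : 0 < alpha ->
  finite_set [set j | theta j != 0] -> finite_set [set j | g j != 0] ->
  mirror_obj h alpha g (mirror_map beta theta) (mirror_map beta (theta - alpha *: g)) =
    (alpha^-1 * (dual_gen beta theta - dual_gen beta (theta - alpha *: g)))%:E.
Proof.
move=> a0 ft fg; have fd := finite_dual_step alpha ft fg.
have [T xT] := powsum_mirror_map fd; rewrite (mirror_objE a0 ft fg xT).
have [hd ->] := mirror_map_eq b0 b1 fd.
have -> : (2 * c)^-1 * T `^ (2 - beta) = dual_gen beta (theta - alpha *: g).
  by move: hd; rewrite (dist_gen_fin b0 b1 xT) => -[].
move: (dual_gen beta theta) (dual_gen beta (theta - alpha *: g)) => u v.
by have -> : v - 2 * v + u = u - v by ring.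
Qed.

Lemma mirror_map_argmin theta g alpha x : 0 < alpha ->
  finite_set [set j | theta j != 0] -> finite_set [set j | g j != 0] ->
  (mirror_obj h alpha g (mirror_map beta theta) (mirror_map beta (theta - alpha *: g)%R)
   <= mirror_obj h alpha g (mirror_map beta theta) x)%E.
Proof.
move=> a0 ft fg; have fd := finite_dual_step alpha ft fg.
have [[T xT]|xy] := powsum_cases x; last by rewrite (mirror_obj_infty g a0 ft xy) leey.
rewrite mirror_obj_mirror_map // (mirror_objE a0 ft fg xT) lee_fin.
rewrite ler_wpM2l ?invr_ge0 ?(ltW a0) //.
have := dist_gen_fenchel_young fd xT; clear xT.
move: ((2 * c)^-1 * T `^ _) (pairing _ x) => u v.
move: (dual_gen beta (theta - _)) (dual_gen beta theta) => y z; lra.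
Qed.

Lemma mirror_argmin_unique theta g alpha x : 0 < alpha ->
  finite_set [set j | theta j != 0] -> finite_set [set j | g j != 0] ->
  (forall y, mirror_obj h alpha g (mirror_map beta theta) x
     <= mirror_obj h alpha g (mirror_map beta theta) y)%E ->
  x = mirror_map beta (theta - alpha *: g).
Proof.
move=> a0 ft fg xmin; have fd := finite_dual_step alpha ft fg.
have := xmin (mirror_map beta (theta - alpha *: g)).
have [[T xT]|xy] := powsum_cases x; last first.
  by rewrite (mirror_obj_infty g a0 ft xy) mirror_obj_mirror_map // leye_eq.
rewrite mirror_obj_mirror_map // (mirror_objE a0 ft fg xT) lee_fin.
rewrite ler_pM2l ?invr_gt0 // => le; apply: (mirror_map_unique b0 b1 fd xT).
move: le; clear xT; rewrite -/c.
move: ((2 * c)^-1 * T `^ _) (pairing _ x) => u v.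
move: (dual_gen beta (theta - _)) (dual_gen beta theta) => y z; lra.
Qed.

End mirror_step.

(** * Regret of mirror descent *)

Section regret.
Context {R : realType} {n : option nat} (beta : R).
Local Notation E := (axis n -> R).
Implicit Types (x y g v theta : E) (gs xs : nat -> E) (alpha L : R).
Hypotheses (b0 : 0 < beta) (b1 : beta <= 1).
Let p := 2 / (2 - beta).
Let c := beta / (2 - beta).
Local Notation h := (dist_gen beta p).

Let facts : [/\ 0 < beta, beta <= 1, 0 < c & 1 < p].
Proof.
move: b0 b1 => B0 B1; split => //; first by rewrite /c divr_gt0 //; lra.
by rewrite /p ltr_pdivlMr //; lra.
Qed.

(** Mirror descent followed in the dual, where its steps are additive and where
    all its points have finite support. *)
Fixpoint dual_path alpha gs (i : nat) : E :=
  if i is l.+1 then dual_path alpha gs l - alpha *: gs l else 0.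

Lemma finite_dual_path alpha gs i :
  (forall l, (l < i)%N -> finite_set [set j | gs l j != 0]) ->
  finite_set [set j | dual_path alpha gs i j != 0].
Proof.
elim: i => [|i IH] fgs; first exact: (@supported_finite _ _ [::]).
by apply: finite_dual_step; [apply: IH => l li; apply: fgs; exact: ltnW|exact: fgs].
Qed.

Lemma mirror_map0 : mirror_map beta 0 = 0 :> E.
Proof.
by apply/funext => j; rewrite /mirror_map /unweight !mul0r /spow sgr0 mul0r mulr0 mul0r.
Qed.

Lemma pairing_dual_path alpha gs i x :
  (forall l, (l < i)%N -> finite_set [set j | gs l j != 0]) ->
  pairing (dual_path alpha gs i) x = - (alpha * \sum_(l < i) pairing (gs l) x).
Proof.
elim: i => [|i IH] fgs.
  by rewrite big_ord0 mulr0 oppr0 (pairing_seq (r := [::])) // big_nil.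
have fi l : (l < i)%N -> finite_set [set j | gs l j != 0].
  by move=> li; apply: fgs; exact: ltnW.
rewrite big_ord_recr /= pairing_dual_step ?IH //; first by ring.
  exact: finite_dual_path.
exact: fgs.
Qed.

(** With [q = 2 / beta] the weights contribute [j ^ (- beta * q) = j ^ (-2)], which
    is summable. So a subgradient with entries in [[-1, 1]] has a dual norm
    bounded independently of the dimension. *)
Lemma dual_sum_step alpha g : 0 < alpha -> finite_set [set j | g j != 0] ->
  (forall j, `|g j| <= 1) ->
  dual_sum beta (- alpha *: g) <= (alpha * 2 `^ (beta / 2)) `^ (2 / beta).
Proof.
move=> a0 /finite_supported[r ur rg] g1; have [B0 B1 _ _] := facts.
have rag : supported r (- alpha *: g).
  by move=> j /rg; rewrite fctE => ->; rewrite scaler0.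
have q0 : 0 <= 2 / beta by rewrite divr_ge0 // ltW.
rewrite (dual_sum_seq B0 B1 ur rag) powRM ?powR_ge0 ?(ltW a0) // -powRrM.
have -> : beta / 2 * (2 / beta) = 1 by field; rewrite gt_eqF.
rewrite powRr1 //; apply: le_trans (ler_wpM2l (powR_ge0 _ _) (sum_pos_inv_sqr ur)).
rewrite mulr_sumr; apply: ler_sum => j _.
have w0 : 0 < (pos j)%:R `^ beta :> R by rewrite powR_gt0 // ltr0n pos_gt0.
have -> : ((pos j)%:R ^+ 2)^-1 = ((pos j)%:R `^ beta)^-1 `^ (2 / beta) :> R.
  rewrite powR_invr ?(ltW w0) // -powRrM.
  have -> : beta * (2 / beta) = 2 by field; rewrite gt_eqF.
  by rewrite powR_mulrn.
rewrite -powRM ?invr_ge0 ?(ltW a0) ?(ltW w0) //; apply: powR_homo => //.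
rewrite /unweight fctE /GRing.scale /= normrM normfV (gtr0_norm w0).
rewrite ler_wpM2r ?invr_ge0 ?(ltW w0) // normrM normrN (gtr0_norm a0).
by rewrite ler_piMr // ltW.
Qed.

(** The potential argument: by smoothness, each step changes [dual_gen] by at most
    its linear part plus [9 * alpha ^+ 2]. *)
Lemma dual_gen_path alpha gs i : 0 < alpha ->
  (forall l, (l < i)%N -> finite_set [set j | gs l j != 0]) ->
  (forall l, (l < i)%N -> forall j, `|gs l j| <= 1) ->
  dual_gen beta (dual_path alpha gs i) <=
    - (alpha * \sum_(l < i) pairing (gs l) (mirror_map beta (dual_path alpha gs l)))
    + 9 * alpha ^+ 2 * i%:R.
Proof.
move=> a0; have [B0 B1 _ _] := facts.
elim: i => [|i IH] fgs gs1.
  by rewrite big_ord0 !mulr0 oppr0 addr0 /= dual_gen0.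
have fi l : (l < i)%N -> finite_set [set j | gs l j != 0].
  by move=> li; apply: fgs; exact: ltnW.
have {}IH := IH fi (fun l li => gs1 l (ltnW li)).
have fd := finite_dual_path alpha fi; have fg := fgs i (ltnSn i).
have fag : finite_set [set j | (- alpha *: gs i) j != 0].
  apply: sub_finite_set fg => j /=; apply: contraNneq.
  by rewrite fctE => ->; rewrite scaler0.
have e0 : 0 < alpha * 2 `^ (beta / 2) by rewrite mulr_gt0 ?powR_gt0.
have := dual_gen_smooth B0 B1 e0 fd fag (dual_sum_step a0 fg (gs1 i (ltnSn i))).
rewrite scaleNr /= => /le_trans; apply.
have -> : pairing (- (alpha *: gs i)) (mirror_map beta (dual_path alpha gs i)) =
    - (alpha * pairing (gs i) (mirror_map beta (dual_path alpha gs i))).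
  have [r ur rg] := finite_supported fg.
  rewrite !(pairing_seq _ ur) // => [|j /rg gj].
    rewrite mulr_sumr -sumrN; apply: eq_bigr => j _.
    by rewrite !fctE /GRing.scale /=; ring.
  by rewrite !fctE gj scaler0 oppr0.
have e2 : (alpha * 2 `^ (beta / 2)) ^+ 2 <= 2 * alpha ^+ 2.
  rewrite exprMn mulrC ler_wpM2r ?sqr_ge0 // -powR_mulrn ?powR_ge0 // -powRrM.
  by rewrite divfK // -[leRHS]powRr1 // ler_powR //; lra.
rewrite big_ord_recr /= -[i.+1]addn1 natrD; lra.
Qed.

(** The Fenchel-Young inequality at [x] bounds the potential of the last dual point
    from below; only the bound [L] on the weighted [1]-norm of [x] is needed because
    it dominates the [p]-norm. *)
Lemma regret_dual_path alpha gs k x L : 0 < alpha -> 0 <= L ->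
  (forall l, (l < k)%N -> finite_set [set j | gs l j != 0]) ->
  (forall l, (l < k)%N -> forall j, `|gs l j| <= 1) ->
  (norm1 (weight beta x) <= L%:E)%E ->
  alpha * \sum_(l < k) pairing (gs l) (mirror_map beta (dual_path alpha gs l) - x)
    <= (2 * c)^-1 * L ^+ 2 + 9 * alpha ^+ 2 * k%:R.
Proof.
move=> a0 L0 fgs gs1 xL; have [B0 B1 c0 p1] := facts.
have [r ur rd] := finite_supported (finite_dual_path alpha fgs).
have l1 : \sum_(j <- r) `|weight beta x j| <= L by exact: ler_sum_esum ur _ xL.
have lp : \sum_(j <- r) `|weight beta x j| `^ p <= L `^ p.
  have -> : \sum_(j <- r) `|weight beta x j| `^ p =
      \sum_(j <- r) `|weight beta x j| * `|weight beta x j| `^ (p - 1).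
    by apply: eq_bigr => j _; rewrite mulr_powRB1 //; lra.
  rewrite -mulr_powRB1 //; last lra.
  apply: (@le_trans _ _ (\sum_(j <- r) `|weight beta x j| * L `^ (p - 1))); last first.
    by rewrite -mulr_suml ler_wpM2r ?powR_ge0.
  rewrite !big_seq; apply: ler_sum => j jr; rewrite ler_wpM2l //; apply: powR_homo => //.
    lra.
  by apply: le_trans l1; rewrite (big_rem j) //= lerDl sumr_ge0.
have := dual_gen_pairing_le b0 b1 ur rd lp.
have -> : (L `^ p) `^ (2 - beta) = L ^+ 2.
  by rewrite -powRrM -powR_mulrn //; congr (_ `^ _); rewrite /p; field; lra.
rewrite pairing_dual_path //.
have := dual_gen_path a0 fgs gs1.
have -> : \sum_(l < k) pairing (gs l) (mirror_map beta (dual_path alpha gs l) - x) =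
   \sum_(l < k) pairing (gs l) (mirror_map beta (dual_path alpha gs l))
   - \sum_(l < k) pairing (gs l) x.
  rewrite -sumrB; apply: eq_bigr => l _.
  have [s us sg] := finite_supported (fgs l (ltn_ord l)).
  rewrite !(pairing_seq _ us sg) -sumrB.
  by apply: eq_bigr => j _; rewrite !fctE mulrBr.
by rewrite -/c; lra.
Qed.

Section losses.
Context {S : Type} (alpha : R) (k : nat) (F : E -> S -> R) (s : k.-tuple S).
Hypotheses (a0 : 0 < alpha) (lossF : loss_class F).

(** Each minimizer is unique, so any run of mirror descent is the image under
    [mirror_map] of the dual path of its own subgradients. *)
Lemma mirror_descent_dual_path xs gs : mirror_descent h alpha F s xs gs ->
  (forall i : 'I_k, subdiff (F^~ (tnth s i)) (xs i) (gs i)) /\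
  forall i, (i <= k)%N -> xs i = mirror_map beta (dual_path alpha gs i).
Proof.
case=> xs0 md; split => [i|]; first by case: (md i).
elim => [|i IH] ik; first by rewrite xs0 /= mirror_map0.
have fgs l : (l < k)%N -> finite_set [set j | gs l j != 0].
  by move=> lk; case: (md (Ordinal lk)) => -[].
have [_ opt] := md (Ordinal ik).
apply: (mirror_argmin_unique b0 b1 a0 _ (fgs i ik)).
  by apply: finite_dual_path => l li; apply: fgs; exact: (ltn_trans li ik).
by move=> y; have := opt y; rewrite /= (IH (ltnW ik)).
Qed.

Lemma avg_regret_le xs gs x L : (0 < k)%N -> 0 <= L ->
  mirror_descent h alpha F s xs gs ->
  (norm1 (weight beta x) <= L%:E)%E ->
  avg_regret F s xs x <= (2 * c)^-1 * L ^+ 2 / (alpha * k%:R) + 9 * alpha.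
Proof.
move=> k0 L0 /mirror_descent_dual_path[sub xsE] xL.
have kp : 0 < k%:R :> R by rewrite ltr0n.
have fgs l : (l < k)%N -> finite_set [set j | gs l j != 0].
  by move=> lk; case: (sub (Ordinal lk)).
have gs1 l : (l < k)%N -> forall j, `|gs l j| <= 1.
  move=> lk; have [_ /(_ (xs l))[_ ]] := lossF (tnth s (Ordinal lk)).
  by apply; exact: (sub (Ordinal lk)).
have := regret_dual_path a0 L0 fgs gs1 xL.
set G := \sum_(l < k) _ => reg.
have FG : \sum_(i < k) (F (xs i) (tnth s i) - F x (tnth s i)) <= G.
  apply: ler_sum => i _; rewrite -xsE; last exact: ltnW.
  have [fg /(_ x)] := sub i.
  have -> : pairing (gs i) (x - xs i) = - pairing (gs i) (xs i - x).
    have [r ur rg] := finite_supported fg.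
    rewrite !(pairing_seq _ ur rg) -sumrN.
    by apply: eq_bigr => j _; rewrite !fctE -mulrN opprB.
  by lra.
rewrite /avg_regret ler_pdivrMl //; apply: le_trans FG _.
rewrite -(ler_pM2l a0); apply: le_trans reg _.
move: (_ * L ^+ 2) => u; rewrite le_eqVlt; apply/orP; left; apply/eqP.
by field; rewrite !gt_eqF.
Qed.

End losses.

(** The state is recomputed from the losses observed so far, choosing a subgradient
    at each point. *)
Definition mirror_state {S : Type} (alpha : R) (l : seq (S * (E -> R))) : E :=
  foldl (fun theta z =>
    theta - alpha *: xget 0 (subdiff z.2 (mirror_map beta theta))) 0 l.

Definition mirror_strategy {S : Type} (alpha : R) (l : seq (S * (E -> R))) : E :=
  mirror_map beta (mirror_state alpha l).

Lemma mirror_strategyP (S : Type) (alpha : R) (k : nat) (F : E -> S -> R)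
    (s : k.-tuple S) : 0 < alpha -> loss_class F ->
  exists gs, mirror_descent h alpha F s
    (fun i => mirror_strategy alpha (take i (observe F s))) gs.
Proof.
move=> a0 lossF; pose ls := map_tuple (fun z => F^~ z) s.
pose xs i := mirror_strategy alpha (take i (observe F s)).
pose gs i := xget 0 (subdiff (nth (fun=> 0) ls i) (xs i)).
have lsE (i : 'I_k) : nth (fun=> 0) ls i = F^~ (tnth s i).
  by rewrite -tnth_nth tnth_map.
have obsE (i : 'I_k) z0 : (nth z0 (observe F s) i).2 = F^~ (tnth s i).
  by rewrite -tnth_nth tnth_map.
have sub (i : 'I_k) : subdiff (F^~ (tnth s i)) (xs i) (gs i).
  by rewrite /gs lsE; apply: xgetPex; case: (lossF (tnth s i)) => _ /(_ (xs i))[].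
have stE i : (i <= k)%N ->
    mirror_state alpha (take i (observe F s)) = dual_path alpha gs i.
  elim: i => [|i IH] ik; first by rewrite take0.
  have io : (i < size (observe F s))%N by rewrite size_tuple.
  pose z0 := (tnth s (Ordinal ik), F^~ (tnth s (Ordinal ik))).
  rewrite (take_nth z0) // /mirror_state -cats1 foldl_cat /= -/(mirror_state _ _).
  rewrite IH ?(ltnW ik) //; congr (_ - _ *: xget 0 (subdiff _ _)).
    exact: etrans (obsE (Ordinal ik) z0) (esym (lsE (Ordinal ik))).
  by rewrite /xs /mirror_strategy IH ?(ltnW ik).
have fgs l : (l < k)%N -> finite_set [set j | gs l j != 0].
  by move=> lk; case: (sub (Ordinal lk)).
exists gs; split => [|i]; first by rewrite take0 /mirror_strategy /= mirror_map0.
split; first exact: sub.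
move=> x; rewrite /mirror_strategy (stE _ (ltnW (ltn_ord i))) (stE _ (ltn_ord i)).
apply: (mirror_map_argmin b0 b1 _ a0); last exact: fgs.
by apply: finite_dual_path => l li; apply: fgs; exact: (ltn_trans li (ltn_ord i)).
Qed.

End regret.

(** * The effective dimension and the regret bound *)

Section effective_dimension.
Context {R : realType} {n : option nat}.
Local Notation E := (axis n -> R).
Implicit Types (x : E) (X : set E) (beta N M : R).

Lemma norm1_ge0 x : (0 <= norm1 x)%E.
Proof. by apply: esum_ge0 => j _; rewrite lee_fin. Qed.

Lemma norm1_eq0 x : (norm1 x <= 0)%E -> x = 0.
Proof.
move=> x0; apply/funext => j; apply/normr0_eq0/eqP; rewrite eq_le normr_ge0 andbT.
have u1 : uniq [:: j] by [].
by have := ler_sum_esum u1 (fun j => normr_ge0 (x j)) x0; rewrite big_seq1.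
Qed.

Lemma norm1_le_sup X x : X x -> (norm1 x <= sup_norm1 X)%E.
Proof. by move=> Xx; apply: ereal_sup_ubound; exists x. Qed.

Lemma norm1_weight_homo beta beta' x : beta <= beta' ->
  (norm1 (weight beta x) <= norm1 (weight beta' x))%E.
Proof.
move=> bb; apply: le_esum => j _; rewrite lee_fin /weight !normrM ler_wpM2r //.
rewrite !ger0_norm ?powR_ge0 // ler_powR // ler1n; exact: pos_gt0.
Qed.

Lemma log_dim_ge1 N : 1 <= log_dim N.
Proof. by rewrite /log_dim le_max lexx. Qed.

(** An exponent below [1 / ln N] is smaller than some admissible exponent, and the
    weighted norms increase with the exponent. *)
Lemma effdim_weight X N beta x : effdim X = N%:E -> X x ->
  0 < beta < (log_dim N)^-1 ->
  (norm1 (weight beta x) <= (expR 1)%:E * sup_norm1 X)%E.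
Proof.
move=> XN Xx /andP[b0 bN]; have l0 : 0 < log_dim N by have := log_dim_ge1 N; lra.
have Nb : N < expR beta^-1.
  have [N0|N0] := leP N 0; first by rewrite (le_lt_trans N0) ?expR_gt0.
  rewrite -[X in X < _](lnK (x := N)) ?posrE // ltr_expR.
  apply: (@le_lt_trans _ _ (log_dim N)); first by rewrite /log_dim le_max lexx orbT.
  by rewrite -[log_dim N]invrK ltf_pV2 ?posrE ?invr_gt0.
have : (effdim X < (expR beta^-1)%:E)%E by rewrite XN lte_fin.
move=> /ereal_inf_lt[_ [b' [b'0 b'X] <-]].
case: eqVneq => [_|b'n0]; first by rewrite ltNge leey.
rewrite lte_fin ltr_expR => bb'.
have b'p : 0 < b' by rewrite lt0r b'n0.
have {}bb' : beta <= b' by move: bb'; rewrite ltf_pV2 ?posrE // => /ltW.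
apply: le_trans (norm1_weight_homo x bb') _; apply: le_trans b'X.
by apply: ereal_sup_ubound; exists x.
Qed.

(** The infimum defining [effdim] is attained: the constraint on the exponent
    [1 / log_dim N] is the limit from the left of the constraints on smaller
    exponents, one finite sum at a time. *)
Lemma effdim_log_dim_weight X N M x : effdim X = N%:E -> sup_norm1 X = M%:E ->
  X x -> (norm1 (weight (log_dim N)^-1 x) <= (expR 1 * M)%:E)%E.
Proof.
move=> XN XM Xx; have l0 : 0 < log_dim N by have := log_dim_ge1 N; clear XN XM; lra.
apply: esum_le_seq => r ur; rewrite lee_fin.
pose G b : R := \sum_(j <- r) `|weight b x j|.
have cG : G b @[b --> (log_dim N)^-1] --> G (log_dim N)^-1.
  apply: cvg_big => [|j _]; first exact: add_continuous.
  apply: cvg_norm; rewrite /weight; apply: cvgMr_tmp.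
  have powE b : (pos j)%:R `^ b = expR (b * ln (pos j)%:R) :> R.
    by rewrite /powR pnatr_eq0 eqn0Ngt pos_gt0.
  rewrite powE; under eq_cvg do rewrite powE.
  apply: (@continuous_cvg _ _ _ _ _ _ expR); first exact: continuous_expR.
  by apply: cvgMr_tmp; exact: cvg_id.
apply: (cvgr_to_le (cvg_at_left_filter cG)).
near=> b; have b0 : 0 < b by near: b; apply: nbhs_left_gt; rewrite invr_gt0.
have bN : b < (log_dim N)^-1 by near: b; exact: nbhs_left_lt.
have := effdim_weight XN Xx _; rewrite XM -EFinM => /(_ b).
by rewrite b0 bN => /(_ isT); exact: ler_sum_esum.
Unshelve. all: by end_near. Qed.

End effective_dimension.

Section regret_bound.
Context {R : realType} {n : option nat}.
Local Notation E := (axis n -> R).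
Implicit Types (x : E) (X : set E) (N M : R) (k : nat).

(** This choice balances, up to constants, the two terms of [avg_regret_le]. *)
Definition stepsize N M k : R := expR 1 * M / Num.sqrt ((log_dim N)^-1 * k%:R).

Let log_dim_facts N : [/\ 0 < log_dim N, 0 < (log_dim N)^-1 & (log_dim N)^-1 <= 1].
Proof.
have l1 := @log_dim_ge1 R N; have l0 : 0 < log_dim N by exact: lt_le_trans l1.
by split; rewrite ?invr_gt0 // invf_le1.
Qed.

Lemma stepsize_gt0 N M k : 0 < M -> (0 < k)%N -> 0 < stepsize N M k.
Proof.
move=> M0 k0; have [_ b0 _] := log_dim_facts N.
by rewrite divr_gt0 ?mulr_gt0 ?expR_gt0 // sqrtr_gt0 mulr_gt0 // ltr0n.
Qed.

Lemma mirror_descent_avg_regret (S : Type) X N M k (F : E -> S -> R)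
    (s : k.-tuple S) (xs gs : nat -> E) x : (0 < k)%N -> 0 < M ->
  effdim X = N%:E -> sup_norm1 X = M%:E ->
  let beta := (log_dim N)^-1 in
  loss_class F ->
  mirror_descent (dist_gen beta (2 / (2 - beta))) (stepsize N M k) F s xs gs ->
  X x ->
  avg_regret F s xs x <= 10 * expR 1 * Num.sqrt (log_dim N) / Num.sqrt k%:R * M.
Proof.
move=> k0 M0 XN XM beta lossF md Xx.
have [l0 b0 b1] := log_dim_facts N; rewrite -/beta in b0 b1.
have L0 : 0 <= expR 1 * M by rewrite mulr_ge0 ?expR_ge0 // ltW.
have a0 := stepsize_gt0 N M0 k0.
have := avg_regret_le b0 b1 a0 lossF k0 L0 md (effdim_log_dim_weight XN XM Xx).
move=> /le_trans; apply; clear XN XM.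
have kp : 0 < k%:R :> R by rewrite ltr0n.
set L := expR 1 * M in L0 *; set a := stepsize N M k in a0 *.
have s0 : 0 < Num.sqrt (beta * k%:R) by rewrite sqrtr_gt0 mulr_gt0.
have s2 : Num.sqrt (beta * k%:R) ^+ 2 = beta * k%:R.
  by rewrite sqr_sqrtr // mulr_ge0 // ltW.
have La : L = a * Num.sqrt (beta * k%:R) by rewrite /a /stepsize divfK // gt_eqF.
have -> : 10 * expR 1 * Num.sqrt (log_dim N) / Num.sqrt k%:R * M = 10 * a.
  rewrite /a /stepsize sqrtrM ?(ltW b0) // /beta sqrtrV ?(ltW l0) //.
  by field; rewrite ?gt_eqF // sqrtr_gt0.
suff : (2 * (beta / (2 - beta)))^-1 * L ^+ 2 / (a * k%:R) <= a by lra.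
rewrite La exprMn s2.
have -> : (2 * (beta / (2 - beta)))^-1 * (a ^+ 2 * (beta * k%:R)) / (a * k%:R)
    = (2 - beta) / 2 * a.
  by field; rewrite ?gt_eqF //; lra.
by rewrite ler_piMl ?(ltW a0) //; lra.
Qed.

Lemma minimax_regret_le X k (B : \bar R) :
  (forall S : Type, exists xhat : seq (S * (E -> R)) -> E,
    forall (F : E -> S -> R) (s : k.-tuple S) x, loss_class F -> X x ->
    ((avg_regret F s (fun i => xhat (take i (observe F s))) x)%:E <= B)%E) ->
  (minimax_regret X k <= B)%E.
Proof.
move=> H; apply: ge_ereal_sup => _ [S ->]; have [xhat xhatP] := H S.
apply: ge_ereal_inf; eexists; first by exists xhat.
by apply: ge_ereal_sup => _ [F [s [x [lF Xx ->]]]]; exact: xhatP.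
Qed.

Lemma minimax_regret_upper X N k : (0 < k)%N -> effdim X = N%:E ->
  (minimax_regret X k <=
   (10 * expR 1 * Num.sqrt (log_dim N) / Num.sqrt k%:R)%:E * sup_norm1 X)%E.
Proof.
move=> k0 XN; have [l0 b0 b1] := log_dim_facts N.
have kp : 0 < k%:R :> R by rewrite ltr0n.
have C0 : 0 < 10 * expR 1 * Num.sqrt (log_dim N) / Num.sqrt k%:R :> R.
  by rewrite divr_gt0 ?mulr_gt0 ?expR_gt0 ?sqrtr_gt0.
apply: minimax_regret_le => S.
case XM : (sup_norm1 X) => [M||].
- have [M0|M0] := leP M 0; last first.
    exists (mirror_strategy (log_dim N)^-1 (stepsize N M k)) => F s x lF Xx.
    have [gs md] := mirror_strategyP b0 b1 s (stepsize_gt0 N M0 k0) lF.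
    rewrite -EFinM lee_fin.
    exact: (mirror_descent_avg_regret k0 M0 XN XM lF md Xx).
  exists (fun=> 0) => F s x lF Xx.
  have x0 : x = 0.
    by apply: norm1_eq0; apply: le_trans (norm1_le_sup Xx) _; rewrite XM lee_fin.
  have M00 : M = 0.
    apply/eqP; rewrite eq_le M0 -lee_fin -XM.
    exact: le_trans (norm1_ge0 x) (norm1_le_sup Xx).
  rewrite M00 mule0 lee_fin /avg_regret big1 ?mulr0 // => i _.
  by rewrite x0 subrr.
- by exists (fun=> 0) => *; rewrite gt0_muley ?lte_fin // leey.
- exists (fun=> 0) => F s x lF Xx.
  by have := le_trans (norm1_ge0 x) (norm1_le_sup Xx); rewrite XM.
Qed.

End regret_bound.

(** * Biased signs *)

Lemma big_tuple_cons (V : Type) (idx : V) (op : Monoid.com_law idx) (T : finType)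
    (k : nat) (f : k.+1.-tuple T -> V) :
  \big[op/idx]_(t : k.+1.-tuple T) f t
    = \big[op/idx]_(s : T) \big[op/idx]_(t : k.-tuple T) f [tuple of s :: t].
Proof.
rewrite pair_bigA /= (reindex (fun p : T * k.-tuple T => [tuple of p.1 :: p.2])) //.
exists (fun t : k.+1.-tuple T => (thead t, [tuple of behead t])) => [[s t] _|t _] /=.
  by congr (_, _); apply: val_inj.
by rewrite -tuple_eta.
Qed.

Section biased_signs.
Context {R : realType} {m : nat}.
Local Notation signs := {ffun 'I_m -> bool}.
Implicit Types (c : 'I_m -> R) (s v : signs) (t : seq signs) (delta : R).

Definition pm1 (b : bool) : R := if b then 1 else -1.

(** The law of independent signs with means [c j]. *)
Definition sign_weight c s : R := \prod_(j < m) ((1 + c j * pm1 (s j)) / 2).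

Lemma sign_weight_ge0 c s : (forall j, `|c j| <= 1) -> 0 <= sign_weight c s.
Proof.
move=> c1; apply: prodr_ge0 => j _; have := c1 j; rewrite ler_norml => /andP[].
by rewrite /pm1; case: (s j); lra.
Qed.

Lemma sum_sign_weight c : \sum_s sign_weight c s = 1.
Proof.
rewrite -(bigA_distr_bigA (fun j b => (1 + c j * pm1 b) / 2)).
by rewrite big1 // => j _; rewrite big_bool /pm1 /=; lra.
Qed.

Lemma sum_sign_weight_coord c j (G : bool -> R) :
  \sum_s sign_weight c s * G (s j) = (1 + c j) / 2 * G true + (1 - c j) / 2 * G false.
Proof.
pose F i b := (1 + c i * pm1 b) / 2 * (if i == j then G b else 1).
transitivity (\sum_(s : signs) \prod_(i < m) F i (s i)).
  apply: eq_bigr => s _; rewrite /F big_split /=; congr (_ * _).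
  by rewrite (bigD1 j) //= eqxx big1 ?mulr1 // => i /negPf ->.
rewrite -(bigA_distr_bigA F) (bigD1 j) //= [X in _ * X]big1 ?mulr1.
  by rewrite big_bool /F eqxx /pm1 /=; field.
by move=> i /negPf ij; rewrite big_bool /F ij /pm1 /=; lra.
Qed.

Definition biased delta v : 'I_m -> R := fun j => delta * pm1 (v j).

Definition flip j v : signs := [ffun i => if i == j then ~~ v i else v i].

Lemma flipK j : involutive (flip j).
Proof.
move=> v; apply/ffunP => i; rewrite !ffunE.
by case: eqP => // _; rewrite negbK.
Qed.

Lemma sign_weight_flip delta v j s :
  sign_weight (biased delta v) s * sign_weight (biased delta (flip j v)) s
    = (1 - delta ^+ 2)
      * sign_weight (fun i => if i == j then 0 else biased delta v i) s ^+ 2.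
Proof.
rewrite /sign_weight expr2 !(bigD1 j (P := xpredT)) //= eqxx /biased ffunE eqxx.
rewrite (eq_bigr (fun i => (1 + delta * pm1 (v i) * pm1 (s i)) / 2)
  (F1 := fun i => (1 + delta * pm1 (flip j v i) * pm1 (s i)) / 2)); last first.
  by move=> i /negPf ij; rewrite ffunE ij.
rewrite (eq_bigr (fun i => (1 + delta * pm1 (v i) * pm1 (s i)) / 2)
  (F1 := fun i => (1 + (if i == j then 0 else delta * pm1 (v i)) * pm1 (s i)) / 2));
  last first.
  by move=> i /negPf ij; rewrite ij.
by rewrite /pm1; case: (v j) (s j) => [] [] /=; field.
Qed.

Definition sample_weight c t : R := \prod_(s <- t) sign_weight c s.

Lemma sample_weight_ge0 c t : (forall j, `|c j| <= 1) -> 0 <= sample_weight c t.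
Proof. by move=> c1; apply: prodr_ge0 => s _; exact: sign_weight_ge0. Qed.

(** The three laws differ only in the factor of coordinate [j], where
    [(1 + delta) * (1 - delta) = 1 - delta ^+ 2] for either outcome. So the product
    of the two opposite weights is a multiple of the square of the unbiased one that
    does not depend on the sample. *)
Lemma sample_weight_flip delta v j t :
  sample_weight (biased delta v) t * sample_weight (biased delta (flip j v)) t
    = (1 - delta ^+ 2) ^+ size t
      * sample_weight (fun i => if i == j then 0 else biased delta v i) t ^+ 2.
Proof.
rewrite /sample_weight; elim: t => [|s t IH]; first by rewrite !big_nil expr1n !mulr1.
by rewrite !big_cons mulrACA sign_weight_flip IH exprMn [X in _ = X * _]exprS mulrACA.
Qed.

Lemma sum_sample_weight c k : \sum_(t : k.-tuple signs) sample_weight c t = 1.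
Proof.
elim: k => [|k IH].
  rewrite (big_pred1 [tuple]) => [|t]; last by apply/esym/eqP; rewrite [t]tuple0.
  by rewrite /sample_weight big_nil.
rewrite big_tuple_cons -[RHS](sum_sign_weight c); apply: eq_bigr => s _.
rewrite -[RHS]mulr1 -IH mulr_sumr; apply: eq_bigr => t _.
by rewrite /sample_weight big_cons.
Qed.

Lemma bernoulli_ineq k (x : R) : 0 <= x <= 1 -> 1 - k%:R * x <= (1 - x) ^+ k.
Proof.
move=> /andP[x0 x1]; elim: k => [|k IH]; first by rewrite mul0r subr0.
rewrite exprS; have x1' : 0 <= 1 - x by lra.
have := ler_wpM2l x1' IH; apply: le_trans.
have : 0 <= k%:R * x ^+ 2 by rewrite mulr_ge0 ?sqr_ge0.
by rewrite -[k.+1]addn1 natrD; lra.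
Qed.

(** No test distinguishes well the two biases of coordinate [j]. Let [u], [u'] and
    [z] be the weights of a sample under the two laws and under the law with
    coordinate [j] unbiased. Since [delta ^+ 2 <= 1 / (4 * k)], Bernoulli's
    inequality gives [u * u' >= 3 / 4 * z ^+ 2], whence both [u] and [u'] are at
    least [(3 * z - u - u') / 2] by the arithmetic-geometric inequality. Whatever
    the test answers, it errs with one of these weights, and the three laws have
    total mass one. *)
Lemma two_point_error delta v j k (b : k.-tuple signs -> bool) :
  0 <= delta <= 1 -> 4 * k%:R * delta ^+ 2 <= 1 ->
  2^-1 <= \sum_(t : k.-tuple signs)
    (sample_weight (biased delta v) t * (b t != v j)%:R
     + sample_weight (biased delta (flip j v)) t * (b t != flip j v j)%:R).
Proof.
move=> /andP[d0 d1] kd.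
have c1 u i : `|biased delta u i| <= 1.
  by rewrite /biased /pm1; case: (u i); rewrite ?mulr1 ?mulrN1 ?normrN ger0_norm.
have q1 i : `|if i == j then 0 else biased delta v i| <= 1.
  by case: ifP; rewrite ?normr0 ?ler01.
pose u t := sample_weight (biased delta v) t.
pose u' t := sample_weight (biased delta (flip j v)) t.
have tot : \sum_(t : k.-tuple signs) (3 * sample_weight
    (fun i => if i == j then 0 else biased delta v i) t - u t - u' t) / 2 = 2^-1.
  rewrite -mulr_suml !sumrB -mulr_sumr !sum_sample_weight; lra.
rewrite -tot; apply: ler_sum => t _.
set z := sample_weight (fun i => _) t.
have [u0 u'0] : 0 <= u t /\ 0 <= u' t by split; exact: sample_weight_ge0.
have z0 : 0 <= z by exact: sample_weight_ge0.
have uu' : 3 / 4 * z ^+ 2 <= u t * u' t.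
  rewrite /u /u' sample_weight_flip size_tuple -/z ler_wpM2r ?sqr_ge0 //.
  have d2 : 0 <= delta ^+ 2 <= 1 by rewrite sqr_ge0 expr_le1.
  by apply: le_trans (bernoulli_ineq k d2); lra.
have u'u : 3 / 4 * z ^+ 2 <= u' t * u t by rewrite [leRHS]mulrC.
have lower (x y : R) : 0 <= x -> 0 <= y -> 3 / 4 * z ^+ 2 <= x * y -> 3 * z <= 3 * x + y.
  move=> x0 y0 xy; rewrite -(@ler_pXn2r _ 2) ?nnegrE //; try lra.
  have := sqr_ge0 (3 * x - y); lra.
rewrite ffunE eqxx -/(u t) -/(u' t); case: (b t) (v j) => [] [] /=.
all: have := lower _ _ u0 u'0 uu'; have := lower _ _ u'0 u0 u'u.
all: rewrite ?mulr0 ?mulr1; lra.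
Qed.

(** Assouad's argument: the error of each coordinate is averaged over all bias
    vectors, paired by [flip]. Some bias vector is at least as bad as the average. *)
Lemma average_error delta k (a : 'I_m -> R) (b : 'I_m -> k.-tuple signs -> bool) :
  (forall j, 0 <= a j) -> 0 <= delta <= 1 -> 4 * k%:R * delta ^+ 2 <= 1 ->
  exists v, 4^-1 * \sum_(j < m) a j <=
    \sum_(t : k.-tuple signs) sample_weight (biased delta v) t
      * \sum_(j < m) a j * (b j t != v j)%:R.
Proof.
move=> a0 d01 kd.
pose err v j := \sum_(t : k.-tuple signs)
  sample_weight (biased delta v) t * (b j t != v j)%:R.
have errE v : \sum_(t : k.-tuple signs) sample_weight (biased delta v) t
      * \sum_(j < m) a j * (b j t != v j)%:R = \sum_(j < m) a j * err v j.
  under eq_bigr do rewrite mulr_sumr.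
  rewrite exchange_big /=; apply: eq_bigr => j _; rewrite mulr_sumr.
  by apply: eq_bigr => t _; rewrite mulrCA.
have pair v j : 2^-1 <= err v j + err (flip j v) j.
  by rewrite /err -big_split; exact: two_point_error.
have half j : #|{: signs}|%:R / 4 <= \sum_v err v j.
  have : \sum_(v : signs) 2^-1 <= \sum_v (err v j + err (flip j v) j) by exact: ler_sum.
  have -> : \sum_v (err v j + err (flip j v) j) = 2 * \sum_v err v j.
    rewrite big_split /= mulr_natl mulr2n; congr (_ + _).
    by rewrite [RHS](reindex_inj (can_inj (flipK j))).
  by rewrite sumr_const -[_ *+ _]mulr_natl; lra.
apply: contrapT => /forallNP none.
have : \sum_(v : signs) \sum_(j < m) a j * err v j
    < \sum_(v : signs) 4^-1 * \sum_(j < m) a j.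
  apply: ltr_sum; first by apply/hasP; exists [ffun=> true]; rewrite ?mem_index_enum.
  by move=> v _; rewrite -errE ltNge; apply/negP/none.
apply/negP; rewrite -leNgt sumr_const -[_ *+ _]mulr_natl exchange_big /=.
rewrite !mulr_sumr; apply: ler_sum => j _; rewrite -mulr_sumr.
have := ler_wpM2l (a0 j) (half j); lra.
Qed.

End biased_signs.

(** * Finite probability laws *)

Section finite_probability.
Context {R : realType} {T : finType}.
Implicit Types (w : T -> R).

Definition code (s : T) : nat := enum_rank s.

Definition coded_weight w (i : nat) : R :=
  if insub i is Some o then w (enum_val (o : 'I_#|T|)) else 0.

Lemma coded_weight_code w s : coded_weight w (code s) = w s.
Proof. by rewrite /coded_weight /code valK enum_rankK. Qed.

Lemma coded_weight_ge0 w : (forall s, 0 <= w s) -> forall i, 0 <= coded_weight w i.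
Proof. by move=> w0 i; rewrite /coded_weight; case: insub. Qed.

Lemma sum_code (f : nat -> \bar R) : (\sum_(i < #|T|) f i = \sum_(s : T) f (code s))%E.
Proof. exact: (reindex _ (onW_bij _ (@enum_rank_bij T))). Qed.

Section measure.
Variable (w : T -> R).
Hypotheses (w0 : forall s, 0 <= w s) (w1 : \sum_s w s = 1).

(** A finite law is transported to [nat], where every set is measurable. *)
Definition finprob : set nat -> \bar R :=
  msum (fun i => mscale (NngNum (coded_weight_ge0 w0 i)) \d_i) #|T|.

HB.instance Definition _ := Measure.on finprob.

Let finprob_setT : finprob [set: nat] = 1%E.
Proof.
transitivity (\sum_(i < #|T|) (coded_weight w i)%:E)%E.
  by apply: eq_bigr => i _; rewrite /= /mscale /= diracT mule1.
rewrite (sum_code (fun i => (coded_weight w i)%:E)).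
by under eq_bigr do rewrite coded_weight_code; rewrite sumEFin w1.
Qed.

HB.instance Definition _ := Measure_isProbability.Build _ _ _ finprob finprob_setT.

Definition finprobability : probability nat R := finprob.

Lemma integral_finprob (f : nat -> \bar R) : (forall i, 0 <= f i)%E ->
  (\int[finprobability]_i f i = \sum_(s : T) (w s)%:E * f (code s))%E.
Proof.
move=> f0; rewrite ge0_integral_measure_sum //=.
rewrite -(eq_bigr _
  (fun s _ => congr1 (fun u => u%:E * f (code s))%E (coded_weight_code w s))).
rewrite -(sum_code (fun i => (coded_weight w i)%:E * f i)%E).
apply: eq_bigr => i _; rewrite ge0_integral_mscale //=.
by rewrite integral_dirac // diracT mul1e.
Qed.

Lemma integral_iid_finprob k (f : k.-tuple nat -> \bar R) :
  measurable_fun [set: k.-tuple nat] f -> (forall t, 0 <= f t)%E ->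
  (\int[iid finprobability k]_t f t =
   \sum_(t : k.-tuple T) (\prod_(s <- t) w s)%:E * f (map_tuple code t))%E.
Proof.
elim: k f => [|k IH] f mf f0.
  rewrite [LHS]integral_dirac // diracT mul1e (big_pred1 [tuple]) => [|t]; last first.
    by apply/esym/eqP; rewrite [t]tuple0.
  by rewrite big_nil mul1e; congr f; apply: val_inj.
rewrite [LHS]ge0_integral_distribution //.
rewrite (fubini_tonelli1 (f \o @cons_tuple_pair _ nat k)); last 2 first.
  - exact: measurableT_comp.
  - by move=> z /=.
rewrite integral_finprob => [|i]; last by apply: integral_ge0 => t _; exact: f0.
rewrite big_tuple_cons; apply: eq_bigr => s _; rewrite /fubini_F /=.
have mfs : measurable_fun [set: k.-tuple nat] (fun t => f (cons_tuple_pair (code s, t))).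
  apply: (measurableT_comp mf); apply: measurableT_comp; last exact: pair1_measurable.
  exact: measurable_cons_tuple_pair.
rewrite (IH _ mfs) => [|t]; last exact: f0.
rewrite ge0_sume_distrr => [|t _]; last by rewrite mule_ge0 ?lee_fin ?prodr_ge0.
apply: eq_bigr => t _; rewrite muleA -EFinM big_cons; congr (_ * f _)%E.
exact: val_inj.
Qed.

End measure.
End finite_probability.

(** * Absolute losses *)

Section absolute_loss.
Context {R : realType} {n : option nat} {m : nat} (e : 'I_m -> axis n).
Hypothesis e_inj : injective e.
Local Notation E := (axis n -> R).
Implicit Types (x y g : E) (b : 'I_m -> R).

Definition abs_loss b x : R := \sum_(j < m) `|x (e j) - b j|.

(** Zero on the coordinates that the loss does not see. *)
Definition abs_loss_subgrad b x : E := fun i =>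
  if [pick j | e j == i] is Some j then Num.sg (x (e j) - b j) else 0.

Lemma abs_loss_subgrad_e b x j : abs_loss_subgrad b x (e j) = Num.sg (x (e j) - b j).
Proof.
rewrite /abs_loss_subgrad; case: pickP => [i /eqP/e_inj -> //|/(_ j)].
by rewrite eqxx.
Qed.

Lemma abs_loss_subgradP b x : subdiff (abs_loss b) x (abs_loss_subgrad b x).
Proof.
pose r := [seq e j | j <- enum 'I_m].
have ur : uniq r by rewrite map_inj_uniq ?enum_uniq.
have sr : supported r (abs_loss_subgrad b x).
  move=> i; apply: contraNeq; rewrite /abs_loss_subgrad.
  case: pickP => [j /eqP <- _|]; last by rewrite eqxx.
  by apply: map_f; rewrite mem_enum.
split; first exact: supported_finite sr.
move=> y; rewrite (pairing_seq _ ur sr) big_map big_enum /= /abs_loss -big_split /=.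
apply: ler_sum => j _; rewrite abs_loss_subgrad_e !fctE.
have -> : y (e j) - x (e j) = (y (e j) - b j) - (x (e j) - b j) by ring.
rewrite mulrBr -normrEsg addrC subrK.
apply: le_trans (ler_norm _) _; rewrite normrM normr_sg.
by case: (_ != 0); rewrite ?mul1r // mul0r.
Qed.

Lemma abs_loss_subdiff_le1 b x g : subdiff (abs_loss b) x g -> forall i, `|g i| <= 1.
Proof.
move=> [_ gP] i.
have bound c : `|c| = 1 -> c * g i <= 1.
  move=> c1; pose z : E := fun l => if l == i then c else 0.
  have := gP (x + z).
  have -> : x + z - x = z by rewrite addrC addKr.
  have -> : pairing g z = c * g i.
    have sz : supported [:: i] (fun l => g l * z l).
      by move=> l; rewrite inE /z => /negPf ->; rewrite mulr0.
    by rewrite /pairing (fsum_seq _ sz) // big_seq1 /z eqxx mulrC.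
  have : abs_loss b (x + z) <= abs_loss b x + \sum_(j < m) `|z (e j)|.
    rewrite -big_split /=; apply: ler_sum => j _; rewrite fctE.
    by rewrite addrAC; exact: ler_normD.
  have : \sum_(j < m) `|z (e j)| <= 1.
    have [[j ej]|none] := pselect (exists j, e j = i).
      rewrite (bigD1 j) //= big1 ?addr0 => [|l lj]; last first.
        by rewrite /z -ej (inj_eq e_inj) (negPf lj) normr0.
      by rewrite /z ej eqxx c1.
    rewrite big1 // => j _; rewrite /z; case: eqP => [ej|_]; last by rewrite normr0.
    by case: none; exists j.
  lra.
have := bound 1; have := bound (-1); rewrite normrN normr1 => /(_ erefl) H1 /(_ erefl) H2.
by rewrite ler_norml; lra.
Qed.

Lemma abs_loss_convex b : convex_function [set: E] (abs_loss b).
Proof.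
move=> t x y _ _; rewrite convRE /abs_loss !mulr_sumr -big_split /=.
apply: ler_sum => j _.
rewrite [X in `|X - b j|](_ : _ = t%:num * x (e j) + (1 - t%:num) * y (e j)); last by [].
rewrite /unstable.onem.
have : 0 <= t%:num :> R by [].
have : t%:num <= 1 :> R by [].
move: (t%:num) => u u1 u0; have {}u1 : 0 <= 1 - u by rewrite subr_ge0.
have -> : u * x (e j) + (1 - u) * y (e j) - b j =
  u * (x (e j) - b j) + (1 - u) * (y (e j) - b j) by ring.
by apply: le_trans (ler_normD _ _) _; rewrite !normrM (ger0_norm u0) (ger0_norm u1).
Qed.

Lemma abs_loss_class (S : Type) (b : S -> 'I_m -> R) :
  loss_class (fun x z => abs_loss (b z) x).
Proof.
move=> z; split; first exact: abs_loss_convex.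
move=> x; split; first by exists (abs_loss_subgrad (b z) x); exact: abs_loss_subgradP.
exact: abs_loss_subdiff_le1.
Qed.

End absolute_loss.

Section tilted_absolute_value.
Context {R : realType}.
Implicit Types (delta a u : R) (b : bool).

(** The expectation of [`|u - s * a|] over a sign [s] of mean [delta * pm1 b]. *)
Definition tilted delta a b u : R :=
  (1 + delta * pm1 b) / 2 * `|u - a| + (1 - delta * pm1 b) / 2 * `|u + a|.

(** A convex function of [u] that is [a] at zero and minimal at [pm1 b * a], with
    value [(1 - delta) * a]. So it is at least [a] on the other side of zero. *)
Lemma tilted_ge delta a b u : 0 <= delta <= 1 -> 0 <= a ->
  (1 - delta) * a + delta * (a * ((0 <= u) != b)%:R) <= tilted delta a b u.
Proof.
move=> /andP[d0 d1] a0; rewrite /tilted /pm1.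
have n1 := ler_norm (u - a); have n2 := ler_norm (u + a).
have n3 := ler_norm (- (u - a)); have n4 := ler_norm (- (u + a)).
rewrite !normrN in n3 n4.
move: (`|u - a|) (`|u + a|) n1 n2 n3 n4 => y z n1 n2 n3 n4.
have D : 0 <= 1 - delta by lra.
have ? := ler_wpM2l D n1; have ? := ler_wpM2l D n2.
have ? := ler_wpM2l D n3; have ? := ler_wpM2l D n4.
have ? := ler_wpM2l d0 n1; have ? := ler_wpM2l d0 n2.
have ? := ler_wpM2l d0 n3; have ? := ler_wpM2l d0 n4.
case: b; case: (leP 0 u) => [u0|/ltW u0] /=; rewrite ?mulr1 ?mulr0 ?mulrN1.
all: have ? : 0 <= y by lra.
all: have ? : 0 <= z by lra.
all: nra.
Qed.

Lemma tilted_min delta a b : 0 <= a -> tilted delta a b (pm1 b * a) = (1 - delta) * a.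
Proof.
move=> a0; rewrite /tilted /pm1; case: b; rewrite ?mul1r ?mulN1r.
  by rewrite subrr normr0 ger0_norm; lra.
by rewrite addNr normr0 -opprD normrN ger0_norm; lra.
Qed.

End tilted_absolute_value.

(** * The lower bound *)

Section lower_bound.
Context {R : realType} {n : option nat}.
Local Notation E := (axis n -> R).
Implicit Types (X : set E) (x : E) (r : seq (axis n)).

Lemma orthosymmetric_signs X x m (e : 'I_m -> axis n) (v : {ffun 'I_m -> bool}) :
  injective e -> orthosymmetric X -> X x ->
  exists2 y, X y & forall j, y (e j) = pm1 (v j) * `|x (e j)|.
Proof.
move=> e_inj oX Xx.
pose sigma : E := fun i =>
  if [pick j | e j == i] is Some j then pm1 (v j) * (if 0 <= x i then 1 else -1) else 1.
exists (fun i => sigma i * x i).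
  apply: oX => // i; rewrite /sigma /pm1; case: pickP => [j _|_]; last by left.
  by case: (v j); case: (0 <= x i); rewrite ?mulr1 ?mul1r ?mulrN1 ?opprK;
    [left|right|right|left].
move=> j; rewrite /sigma; case: pickP => [i /eqP/e_inj ->|/(_ j)]; last by rewrite eqxx.
case: (leP 0 (x (e j))) => [x0|x0]; first by rewrite mulr1 ger0_norm.
by rewrite mulrN1 mulNr ltr0_norm // mulrN.
Qed.

Section hard_instance.
Context {m k : nat} (e : 'I_m -> axis n) (a : 'I_m -> R) (delta : R).
Hypotheses (e_inj : injective e) (a0 : forall j, 0 <= a j) (delta01 : 0 <= delta <= 1).
Local Notation signs := {ffun 'I_m -> bool}.
Implicit Types (v s : signs).

Definition decode (z : nat) : signs :=
  if insub z is Some o then enum_val (o : 'I_#|{: signs}|) else [ffun=> true].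

Lemma codeK s : decode (code s) = s.
Proof. by rewrite /decode /code valK enum_rankK. Qed.

(** Its subgradients have entries in [[-1, 1]], and its risk is a sum over the
    coordinates of tilted absolute values, minimal at signed copies of [a]. *)
Definition hard_loss : E -> nat -> R :=
  fun x z => abs_loss e (fun j => pm1 (decode z j) * a j) x.

Lemma hard_loss_class : loss_class hard_loss.
Proof. exact: (abs_loss_class e_inj). Qed.

Lemma hard_loss_ge0 x z : 0 <= hard_loss x z.
Proof. by apply: sumr_ge0. Qed.

Lemma biased_le1 v j : `|biased delta v j| <= 1.
Proof.
case/andP: delta01 => d0 d1; rewrite /biased /pm1.
by case: (v j); rewrite ?mulr1 ?mulrN1 ?normrN ger0_norm.
Qed.

Definition hard_prob v : probability nat R :=
  finprobability (fun s => sign_weight_ge0 s (biased_le1 v)) (sum_sign_weight _).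

Lemma risk_hard v x :
  risk hard_loss (hard_prob v) x = (\sum_(j < m) tilted delta (a j) (v j) (x (e j)))%:E.
Proof.
rewrite /risk integral_finprob => [|z]; last by rewrite lee_fin hard_loss_ge0.
under eq_bigr do rewrite -EFinM /hard_loss codeK /abs_loss mulr_sumr.
rewrite sumEFin exchange_big /=; congr EFin; apply: eq_bigr => j _.
rewrite (sum_sign_weight_coord _ j (fun b => `|x (e j) - pm1 b * a j|)) /tilted /biased.
by rewrite /pm1 mul1r mulN1r opprK.
Qed.

Lemma risk_defined_hard v : risk_defined hard_loss (hard_prob v).
Proof.
move=> x; apply/integrableP; split; first by [].
under eq_integral do rewrite abse_EFin ger0_norm ?hard_loss_ge0 //.
by have := risk_hard v x; rewrite /risk => ->; rewrite ltry.
Qed.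

Lemma inf_risk_hard v X : (exists2 x, X x & forall j, x (e j) = pm1 (v j) * a j) ->
  ereal_inf [set risk hard_loss (hard_prob v) x | x in X]
    = (\sum_(j < m) (1 - delta) * a j)%:E.
Proof.
move=> [x Xx xE]; apply/eqP; rewrite eq_le; apply/andP; split.
  apply: ereal_inf_lbound; exists x => //; rewrite risk_hard; congr EFin.
  by apply: eq_bigr => j _; rewrite xE tilted_min.
apply: le_ereal_inf_tmp => _ [y _ <-]; rewrite risk_hard lee_fin.
apply: ler_sum => j _; apply: le_trans (tilted_ge _ _ delta01 (a0 j)).
case/andP: delta01 => d0 _.
by rewrite lerDl mulr_ge0 // mulr_ge0.
Qed.

(** The excess is nonnegative even outside [X], because the minimum of the risk over
    all points is attained in [X]. *)
Lemma expected_excess_hard v X (xhat : k.-tuple nat -> E) :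
  (exists2 x, X x & forall j, x (e j) = pm1 (v j) * a j) ->
  coord_measurable xhat ->
  ((delta * \sum_(t : k.-tuple signs) sample_weight (biased delta v) t
      * \sum_(j < m) a j * ((0 <= xhat (map_tuple code t) (e j)) != v j)%:R)%:E
   <= expected_excess X hard_loss (hard_prob v) xhat)%E.
Proof.
move=> Xv mx; rewrite /expected_excess (inf_risk_hard Xv).
pose G t := \sum_(j < m) (tilted delta (a j) (v j) (xhat t (e j)) - (1 - delta) * a j).
have GE t : (risk hard_loss (hard_prob v) (xhat t) - (\sum_(j < m) (1 - delta) * a j)%:E
    = (G t)%:E)%E by rewrite risk_hard -EFinB -sumrB.
under eq_integral do rewrite GE.
have errG t : delta * (\sum_(j < m) a j * ((0 <= xhat t (e j)) != v j)%:R) <= G t.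
  rewrite mulr_sumr; apply: ler_sum => j _.
  by rewrite lerBrDl; exact: tilted_ge.
case/andP: delta01 => d0 _.
have G0 t : 0 <= G t.
  by apply: le_trans (errG t); rewrite mulr_ge0 // sumr_ge0 // => j _; rewrite mulr_ge0.
have mG : measurable_fun [set: k.-tuple nat] G.
  apply: measurable_sum => j; apply: measurable_funB => //; apply: measurable_funD.
    apply: measurable_funM => //; apply: measurableT_comp => //.
    by apply: measurable_funB => //; exact: mx.
  apply: measurable_funM => //; apply: measurableT_comp => //.
  by apply: measurable_funD => //; exact: mx.
rewrite integral_iid_finprob => [|| t]; [|exact/measurable_EFinP|by rewrite lee_fin].
rewrite mulr_sumr -sumEFin; apply: lee_sum => t _.
rewrite -EFinM lee_fin mulrCA ler_wpM2l //.
by apply: sample_weight_ge0 => j; exact: biased_le1.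
Qed.

End hard_instance.

(** With the bias [delta = 1 / (2 * sqrt k)] a quarter of the signs is missed on
    average, and a missed sign [j] costs [delta * `|x j|]. *)
Lemma oracle_minimax_risk_ge X x r k : orthosymmetric X -> X x -> uniq r -> (0 < k)%N ->
  (((8 * Num.sqrt k%:R)^-1 * \sum_(i <- r) `|x i|)%:E
    <= minimax_risk oracle_procedures X k)%E.
Proof.
move=> oX Xx ur k0; pose m := size r.
pose e (j : 'I_m) : axis n := tnth (in_tuple r) j.
have e_inj : injective e by apply/tuple_uniqP.
pose a j : R := `|x (e j)|; have a0 j : 0 <= a j by exact: normr_ge0.
have -> : \sum_(i <- r) `|x i| = \sum_(j < m) a j by rewrite big_tnth.
have k1 : 1 <= k%:R :> R by rewrite ler1n.
pose c : R := Num.sqrt k%:R; have c1 : 1 <= c by rewrite -[leLHS]sqrtr1 ler_sqrt.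
have c2 : c ^+ 2 = k%:R by rewrite sqr_sqrtr // ler0n.
pose delta := (2 * c)^-1.
have delta01 : 0 <= delta <= 1 by rewrite invr_ge0 invf_le1 //; lra.
have kd : 4 * k%:R * delta ^+ 2 <= 1.
  by rewrite le_eqVlt; apply/orP; left; apply/eqP; rewrite -c2 /delta; field; lra.
apply: le_trans; last first.
  by apply: ereal_sup_ubound; exists _, nat, setT; reflexivity.
apply: le_ereal_inf_tmp => _ [_ [xhat mx <-] <-].
pose F := hard_loss e a; have lF : loss_class F by exact: hard_loss_class.
pose xh (t : k.-tuple nat) := xhat (observe F t).
have [v vP] := average_error (fun j t => 0 <= xh (map_tuple code t) (e j)) a0 delta01 kd.
apply: (@le_trans _ _ (expected_excess X F (hard_prob delta01 v) xh)); last first.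
  apply: ereal_sup_ubound; exists F, (hard_prob delta01 v); split => //.
  exact: risk_defined_hard.
have mxh : coord_measurable xh by exact: (mx F lF).
have Xv := orthosymmetric_signs v e_inj oX Xx.
apply: le_trans (expected_excess_hard a0 delta01 Xv mxh).
rewrite lee_fin; case/andP: (delta01) => d0 _.
apply: le_trans (ler_wpM2l d0 vP); rewrite mulrA.
rewrite le_eqVlt; apply/orP; left; apply/eqP; congr (_ * _).
by rewrite -/c /delta; field; lra.
Qed.

(** A procedure that sees the losses may ignore them. *)
Lemma minimax_risk_oracle_le_sample X k :
  (minimax_risk oracle_procedures X k <= minimax_risk (@sample_procedures R n) X k)%E.
Proof.
apply: ge_ereal_sup => _ [d [S [PP ->]]].
apply: le_trans; last first.
  by apply: ereal_sup_ubound; exists d, S, PP; reflexivity.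
apply: le_ereal_inf_tmp => _ [_ [xhat mx <-] <-].
pose xh (t : k.-tuple (S * (E -> R))) := xhat (map_tuple fst t).
have xhE F : (fun s : k.-tuple S => xh (observe F s)) = xhat.
  apply/funext => s; congr xhat; apply: val_inj => /=.
  by rewrite -map_comp; exact: map_id.
apply: ge_ereal_inf; eexists.
  exists (fun F s => xh (observe F s)); last reflexivity.
  by exists xh => // F _; rewrite xhE.
apply: ge_ereal_sup => _ [F [P [lF PP_P rF ->]]]; rewrite xhE.
by apply: ereal_sup_ubound; exists F, P.
Qed.

Lemma ln3_ge1 : 1 <= ln 3 :> R.
Proof. by rewrite -ler_expR lnK ?posrE // expR1_le3. Qed.

Lemma oracle_minimax_risk_lower X k : orthosymmetric X -> (0 < k)%N ->
  (((8 * Num.sqrt (ln 3))^-1 / Num.sqrt k%:R)%:E * sup_norm1 X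
     <= minimax_risk oracle_procedures X k)%E.
Proof.
move=> oX k0; set c := _ / _; set M := minimax_risk _ _ _.
have l1 : 1 <= Num.sqrt (ln 3) :> R.
  by rewrite -[leLHS]sqrtr1 ler_sqrt ?ln3_ge1 ?(le_trans _ ln3_ge1).
have s0 : 0 < Num.sqrt k%:R :> R by rewrite sqrtr_gt0 ltr0n.
have c0 : 0 < c by rewrite divr_gt0 // invr_gt0; lra.
have cle : c <= (8 * Num.sqrt k%:R)^-1.
  rewrite /c invfM mulrAC -invfM ler_piMr ?invr_ge0 ?mulr_ge0 ?(ltW s0) //.
  by rewrite invf_le1 //; lra.
rewrite -lee_pdivlMl //; apply: ge_ereal_sup => _ [x Xx <-].
apply: esum_le_seq => r ur; rewrite lee_pdivlMl //.
apply: le_trans (oracle_minimax_risk_ge oX Xx ur k0).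
by rewrite -EFinM lee_fin ler_wpM2r // sumr_ge0.
Qed.

End lower_bound.

Theorem proposition10 (R : realType) :
  exists C : R, 0 < C /\
  forall (n : option nat) (X : set (axis n -> R)) (k : nat),
  (0 < k)%N -> orthosymmetric X -> convex_set X ->
  (((8 * Num.sqrt (ln 3))^-1 / Num.sqrt k%:R)%:E * sup_norm1 X
     <= minimax_risk sample_procedures X k)%E /\
  (((8 * Num.sqrt (ln 3))^-1 / Num.sqrt k%:R)%:E * sup_norm1 X
     <= minimax_risk oracle_procedures X k)%E /\
  forall N : R, effdim X = N%:E ->
  let bound := ((C * Num.sqrt (log_dim N) / Num.sqrt k%:R)%:E * sup_norm1 X)%E in
  (minimax_regret X k <= bound)%E /\
  ((0 < sup_norm1 X)%E ->
   let beta := (log_dim N)^-1 in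
   let p := 2 / (2 - beta) in
   exists2 alpha : R, 0 < alpha &
   forall (S : Type) (F : (axis n -> R) -> S -> R) (s : k.-tuple S),
   loss_class F ->
   (exists xs gs, mirror_descent (dist_gen beta p) alpha F s xs gs) /\
   forall xs gs, mirror_descent (dist_gen beta p) alpha F s xs gs ->
   forall x, X x -> ((avg_regret F s xs x)%:E <= bound)%E).
Proof.
exists (10 * expR 1); split; first by rewrite mulr_gt0 ?expR_gt0.
move=> n X k k0 oX _; have lower := oracle_minimax_risk_lower oX k0.
split; first exact: le_trans lower (minimax_risk_oracle_le_sample X k).
split => // N XN bound; split; first exact: minimax_regret_upper.
move=> M0 beta p.
have l1 := log_dim_ge1 N; have l0 : 0 < log_dim N by exact: lt_le_trans l1.
have b0 : 0 < beta by rewrite invr_gt0.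
have b1 : beta <= 1 by rewrite invf_le1.
have run alpha S F (s : k.-tuple S) : 0 < alpha -> loss_class F ->
    exists xs gs, mirror_descent (@dist_gen R n beta p) alpha F s xs gs.
  by move=> a0 lF; eexists; exact: mirror_strategyP.
case XM : (sup_norm1 X) M0 => [M||] // M0; last first.
  exists 1 => // S F s lF; split; first exact: run.
  move=> xs gs _ x _; rewrite /bound XM gt0_muley ?leey // lte_fin.
  by rewrite divr_gt0 ?mulr_gt0 ?expR_gt0 ?sqrtr_gt0 ?ltr0n.
rewrite lte_fin in M0; exists (stepsize N M k); first exact: stepsize_gt0.
move=> S F s lF; split; first by apply: run => //; exact: stepsize_gt0.
move=> xs gs md x Xx; rewrite /bound XM -EFinM lee_fin.
exact: (mirror_descent_avg_regret k0 M0 XN XM lF md Xx).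
Qed.
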